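(* Let $E_{/\mathbb{R}}$ be an elliptic curve, given by an equation $y^2=f(x)$ with $f\in\mathbb{R}[x]$ a separable cubic, and let $t\in\{1,3\}$ be the number of real roots of $f$. For $N\in\mathbb{Z}^+$ let $\mathcal{C}_N(E)$ be the set of cyclic subgroups of $E(\mathbb{C})$ of order $N$, and $\mathcal{C}_N(E)^c$ the subset fixed by complex conjugation. Suppose $N$ has exactly $r$ distinct odd prime divisors. (a) If $N$ is odd, then $\#\mathcal{C}_N(E)^c=2^r$. (b) If $N\equiv 2\pmod 4$, then $\#\mathcal{C}_N(E)^c=t\cdot 2^r$. (c) If $N\equiv 4\pmod 8$, then $\#\mathcal{C}_N(E)^c\in\{2^{r+1},2^{r+2}\}$. *)

(* Defs.v *)
From HB Require Import structures.
From mathcomp Require Import all_boot all_order all_algebra.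
From mathcomp Require Import separable.
From mathcomp Require Import classical_sets functions cardinality reals.
From mathcomp Require Import complex.

Set Implicit Arguments.
Unset Strict Implicit.
Unset Printing Implicit Defensive.

Import GRing.Theory.
Local Open Scope classical_set_scope.
Local Open Scope card_scope.
Local Open Scope ring_scope.

Section CubicModel.
Variables (K : fieldType).

Inductive point : Type :=
  | Infinity : point
  | Affine of K & K.

Variable f : {poly K}.

Definition curve : set point := [set P |
  match P with
  | Infinity => True
  | Affine x y => y ^+ 2 = f.[x]
  end].

Definition ec_opp (P : point) : point :=
  match P with
  | Infinity => Infinity
  | Affine x y => Affine x (- y)
  end.

(* Chord-and-tangent law with neutral element Infinity. The cubic f need not
   be monic: a line y = l * x + m meets the curve in three points whose
   abscissas sum to (l ^ 2 - f_2) / f_3. *)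
Definition ec_add (P Q : point) : point :=
  match P, Q with
  | Infinity, _ => Q
  | _, Infinity => P
  | Affine x1 y1, Affine x2 y2 =>
    if (x1 == x2) && (y1 == - y2) then Infinity else
    let l := if x1 == x2 then f^`().[x1] / (2 * y1)
             else (y2 - y1) / (x2 - x1) in
    let x3 := (l ^+ 2 - f`_2) / f`_3 - x1 - x2 in
    Affine x3 (l * (x1 - x3) - y1)
  end.

Definition ec_subgroup (S : set point) : Prop :=
  [/\ S `<=` curve,
      S Infinity,
      forall P, S P -> S (ec_opp P)
    & forall P Q, S P -> S Q -> S (ec_add P Q)].

Definition cyclic_subgroups (N : nat) : set (set point) := [set S |
  [/\ ec_subgroup S,
      exists P, S = smallest ec_subgroup [set P]
    & S #= `I_N]].

End CubicModel.

Arguments Infinity {K}.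

Section ComplexConjugation.
Variable R : realType.

Definition complexify (f : {poly R}) : {poly R[i]} :=
  map_poly (real_complex R) f.

Definition conj_point (P : point R[i]) : point R[i] :=
  match P with
  | Infinity => Infinity
  | Affine x y => Affine (conjc x) (conjc y)
  end.

Definition real_cyclic_subgroups (f : {poly R}) (N : nat) :
    set (set (point R[i])) :=
  [set S | cyclic_subgroups (complexify f) N S /\ conj_point @` S = S].

End ComplexConjugation.

(* Main.v *)
(* Each stable cyclic subgroup splits along N = prod p^k into stable cyclic
   subgroups of order p^k.  Complex conjugation acts on a generator of a stable
   subgroup by some u with u^2 = 1 mod p^k; for p odd this forces u = 1 or
   u = -1, so the generator is a real point of y^2 = f(x) or of its quadratic
   twist y^2 = - f(x).  The identity component of the real points of a cubic
   curve is a circle, and odd torsion lies in it, so both curves have exactly one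
   cyclic subgroup of order p^k: two choices for each odd p.  Stable subgroups of
   order 2 are the real roots of f.  A point of order 4 with abscissa x doubles to
   (e, 0) iff a (x - e)^2 = f'(e), where a is the leading coefficient, and its
   subgroup is stable iff x is real; there are two such x for every real root e
   with a f'(e) > 0, and one or two such roots.

   Associativity of the chord-and-tangent law comes from the ideals of the
   coordinate ring K[x, y] / (y^2 - f): the ideal of P + Q is equivalent to the
   product of those of P and Q, and distinct points have inequivalent ideals
   because no norm p^2 - q^2 f has degree 1. *)

From HB Require Import structures.
Require Import Defs.
From mathcomp Require Import all_boot all_order all_algebra.
From mathcomp Require Import separable cyclic.
From mathcomp Require Import classical_sets functions cardinality reals.
From mathcomp Require Import complex polyrcf.
From mathcomp Require Import ring lra zify.

Set Implicit Arguments.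
Unset Strict Implicit.
Unset Printing Implicit Defensive.

Import Order.TTheory GRing.Theory Num.Theory.
Local Open Scope classical_set_scope.
Local Open Scope card_scope.
Local Open Scope ring_scope.

(** The circle is obtained without topology or integration. What is proved about the real points is
    one inequality: in the order that runs from infinity along the upper half to the origin and back
    along the lower half, subtracting an earlier point from a later one does not lead past the later
    one. This decides when an addition wraps around, and counting the wraps yields a universal cover
    that is a totally ordered group. Its order, but not its addition, is compared with that of the
    real line; completeness then divides a full turn into [n] equal parts, and the image of one part
    generates the [n]-torsion. Hence any monotone coordinate on the circle is good enough.

    One real model serves both signs of conjugation: the curve and its twist are brought to the form
    [y^2 = x (x^2 + b x + d)] with [0] the largest real root, and a real or purely imaginary scaling
    of [y] carries the model into the complex curve. *)

(** * The group law *)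

(* [(p, q)] stands for [p + q y] in K[x, y] / (y^2 - f). *)
Definition coord_ring (K : fieldType) (f : {poly K}) : Type :=
  ({poly K} * {poly K})%type.

(** * The coordinate ring, its norm and the ideals of points *)

Section CoordRing.
Variables (K : fieldType) (f : {poly K}).
Local Notation A := (coord_ring f).

HB.instance Definition _ :=
  GRing.Zmodule.copy A ({poly K} * {poly K})%type.

Definition coord_mul (u v : A) : A :=
  (u.1 * v.1 + u.2 * v.2 * f, u.1 * v.2 + u.2 * v.1).

Fact coord_mulA : associative coord_mul.
Proof. by move=> [a b] [c d] [e g]; congr pair => /=; ring. Qed.
Fact coord_mulC : commutative coord_mul.
Proof. by move=> [a b] [c d]; congr pair => /=; ring. Qed.
Fact coord_mul1 : left_id ((1, 0) : A) coord_mul.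
Proof. by move=> [a b]; congr pair => /=; ring. Qed.
Fact coord_mulD : left_distributive coord_mul +%R.
Proof. by move=> [a b] [c d] [e g]; congr pair => /=; ring. Qed.
Fact coord_1neq0 : ((1, 0) : A) != 0.
Proof. by apply/eqP => -[/eqP]; rewrite oner_eq0. Qed.

HB.instance Definition _ := GRing.Zmodule_isComNzRing.Build A
  coord_mulA coord_mulC coord_mul1 coord_mulD coord_1neq0.

Lemma coord_mulE (u v : A) :
  u * v = (u.1 * v.1 + u.2 * v.2 * f, u.1 * v.2 + u.2 * v.1).
Proof. by []. Qed.

Definition coord_norm (u : A) : {poly K} := u.1 ^+ 2 - u.2 ^+ 2 * f.

Lemma coord_normM u v : coord_norm (u * v) = coord_norm u * coord_norm v.
Proof. by rewrite /coord_norm coord_mulE /=; ring. Qed.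

Hypothesis f_cubic : size f = 4%N.

(** A square has even degree and a square times the cubic has odd degree, so the leading terms
    cannot cancel. The boolean factor covers [u.2 = 0]. *)
Lemma size_coord_norm u : size (coord_norm u) =
  maxn (size u.1).*2.-1 ((size u.2 != 0) * (size u.2).*2.+2).
Proof.
have f0 : f != 0 by rewrite -size_poly_eq0 f_cubic.
have sz2 (p : {poly K}) : size (p ^+ 2) = (size p).*2.-1.
  have [->|p0] := eqVneq p 0; first by rewrite expr0n size_poly0.
  by rewrite expr2 size_mul // addnn.
have szf : size (u.2 ^+ 2 * f) = ((size u.2 != 0) * (size u.2).*2.+2)%N.
  have [->|q0] := eqVneq u.2 0; first by rewrite expr0n mul0r size_poly0.
  rewrite size_mul ?expf_neq0 // sz2 f_cubic size_poly_eq0 q0 mul1n.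
  move: q0; rewrite -size_poly_gt0; lia.
rewrite /coord_norm; have [lt|] := ltnP (size (u.1 ^+ 2)) (size (u.2 ^+ 2 * f)).
  by rewrite addrC size_polyDl ?size_polyN // -sz2 -szf (maxn_idPr (ltnW lt)).
rewrite leq_eqVlt => /orP[/eqP eq|lt].
  move: eq; rewrite -sz2 -szf; rewrite szf sz2.
  have [/eqP|u20] := eqVneq (size u.2) 0%N; last by lia.
  rewrite size_poly_eq0 => /eqP ->; rewrite expr0n mul0r subr0 sz2.
  by case: (size u.1) => // n; lia.
by rewrite size_polyDl ?size_polyN // -sz2 -szf (maxn_idPl (ltnW lt)).
Qed.

Lemma coord_norm_eq0 u : (coord_norm u == 0) = (u == 0).
Proof.
apply/idP/eqP => [|->]; last first.
  by rewrite /coord_norm /= expr0n mul0r subr0.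
rewrite -size_poly_eq0 size_coord_norm => h.
have /eqP : size u.2 = 0%N by move: h; case: eqP => //=; lia.
have /eqP : size u.1 = 0%N by move: h; lia.
by rewrite !size_poly_eq0; case: u {h} => p q /= /eqP -> /eqP ->.
Qed.

Lemma coord_mul_eq0 (u v : A) : (u * v == 0) = (u == 0) || (v == 0).
Proof. by rewrite -!coord_norm_eq0 coord_normM mulf_eq0. Qed.

Lemma coord_mulI (u : A) : u != 0 -> injective ( *%R u).
Proof.
move=> u0 v w /eqP; rewrite -subr_eq0 -mulrBr coord_mul_eq0 (negPf u0) /=.
by rewrite subr_eq0 => /eqP.
Qed.

Definition is_ideal (I : A -> Prop) :=
  [/\ I 0, forall u v, I u -> I v -> I (u + v) & forall c u, I u -> I (c * u)].

(* The additive subgroup generated by the products, given impredicatively. *)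
Definition ideal_mul (I J : A -> Prop) : A -> Prop := fun u =>
  forall D : A -> Prop, (forall v w, D v -> D w -> D (v + w)) ->
  (forall i j, I i -> J j -> D (i * j)) -> D u.

Lemma ideal_mulP (I J : A -> Prop) i j : I i -> J j -> ideal_mul I J (i * j).
Proof. by move=> Ii Jj D _; apply. Qed.

Lemma ideal_mulD (I J : A -> Prop) u v :
  ideal_mul I J u -> ideal_mul I J v -> ideal_mul I J (u + v).
Proof. by move=> Iu Iv D DD DM; exact: DD (Iu D DD DM) (Iv D DD DM). Qed.

Lemma ideal_mulC I J u : ideal_mul I J u -> ideal_mul J I u.
Proof.
apply; first by move=> v w; apply: ideal_mulD.
by move=> i j Ii Jj; rewrite mulrC; exact: ideal_mulP Jj Ii.
Qed.

Lemma ideal_mulA I J L u :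
  ideal_mul (ideal_mul I J) L u -> ideal_mul I (ideal_mul J L) u.
Proof.
apply; first by move=> v w; apply: ideal_mulD.
move=> k l Ik Ll; apply: (Ik (fun k => ideal_mul I (ideal_mul J L) (k * l))).
  by move=> v w hv hw; rewrite mulrDl; apply: ideal_mulD.
by move=> i j Ii Jj; rewrite -mulrA; exact: ideal_mulP Ii (ideal_mulP Jj Ll).
Qed.

Lemma is_ideal_mul I J : is_ideal I -> is_ideal J -> is_ideal (ideal_mul I J).
Proof.
move=> [I0 ID IM] [J0 JD JM]; split.
- by rewrite -(mulr0 0); exact: ideal_mulP.
- by move=> u v; apply: ideal_mulD.
- move=> c u Iu; apply: (Iu (fun u => ideal_mul I J (c * u))).
    by move=> v w hv hw; rewrite mulrDr; apply: ideal_mulD.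
  by move=> i j Ii Jj; rewrite mulrA; exact: ideal_mulP (IM c i Ii) Jj.
Qed.

(* [a I = b J] for nonzero [a] and [b], i.e. equality in the ideal class
   monoid. *)
Definition same_class (I J : A -> Prop) := exists a b : A,
  [/\ a != 0, b != 0, forall i, I i -> exists2 j, J j & a * i = b * j
    & forall j, J j -> exists2 i, I i & a * i = b * j].

Lemma same_class_sym I J : same_class I J -> same_class J I.
Proof.
by move=> [a [b [a0 b0 h1 h2]]]; exists b, a; split=> // i /[dup] Ii;
  [move=> /h2 | move=> /h1] => -[j Jj e]; exists j.
Qed.

Lemma same_class_trans J I L :
  same_class I J -> same_class J L -> same_class I L.
Proof.
move=> [a [b [a0 b0 h1 h2]]] [c [d [c0 d0 h3 h4]]].
exists (a * c), (b * d); rewrite !coord_mul_eq0 !negb_or; split; rewrite ?a0 ?b0//.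
  move=> i /h1[j /h3[l Ll e'] e]; exists l => //.
  by rewrite mulrAC e mulrAC -mulrA e' mulrA.
move=> l /h4[j /h2[i Ii e] e']; exists i => //.
by rewrite mulrAC e mulrAC -mulrA e' mulrA.
Qed.

Lemma same_class_eq (I J : A -> Prop) :
  (forall u, I u <-> J u) -> same_class I J.
Proof.
move=> IJ; exists 1, 1; split; rewrite ?oner_neq0 // => i.
  by move=> /IJ; exists i.
by move=> /IJ; exists i.
Qed.

Lemma same_class_mul I J L :
  same_class I J -> same_class (ideal_mul I L) (ideal_mul J L).
Proof.
move=> [a [b [a0 b0 h1 h2]]]; exists a, b; split=> // u.
  move/(_ (fun u => exists2 j, ideal_mul J L j & a * u = b * j)); apply.
    move=> v w [v' hv ev] [w' hw ew]; exists (v' + w').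
      exact: ideal_mulD.
    by rewrite !mulrDr ev ew.
  move=> i l /h1[j Jj e] Ll; exists (j * l); first exact: ideal_mulP Jj Ll.
  by rewrite !mulrA e.
move/(_ (fun u => exists2 i, ideal_mul I L i & a * i = b * u)); apply.
  move=> v w [v' hv ev] [w' hw ew]; exists (v' + w').
    exact: ideal_mulD.
  by rewrite !mulrDr ev ew.
move=> j l /h2[i Ii e] Ll; exists (i * l); first exact: ideal_mulP Ii Ll.
by rewrite !mulrA e.
Qed.

(** The point at infinity lies outside the affine curve and gets the unit ideal, which is the
    neutral class. *)
Definition point_ideal (P : Defs.point K) : A -> Prop := fun u =>
  if P is Affine x y then u.1.[x] + u.2.[x] * y = 0 else True.

Lemma is_ideal_point P : curve f P -> is_ideal (point_ideal P).
Proof.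
case: P => [|x y] //= e; split=> /=; first by rewrite !horner0 mul0r addr0.
  by move=> u v hu hv; rewrite !hornerD -(addr0 0) -{1}hu -hv; ring.
move=> c u hu; rewrite !hornerE -e.
by rewrite -(mulr0 (c.1.[x] + c.2.[x] * y)) -hu; ring.
Qed.

Definition coord_poly (p : {poly K}) : A := (p, 0).
Definition coord_const (c : K) : A := (c%:P, 0).
Definition coord_vert (x : K) : A := ('X - x%:P, 0).
Definition coord_line (l m : K) : A := (- (l%:P * 'X + m%:P), 1).
(** The reflection of the line [y = l x + m] in the axis, which is its conjugate over K[x]: the
    product of the two is [f - (l x + m)^2]. *)
Definition coord_line' (l m : K) : A := (l%:P * 'X + m%:P, 1).

(** Modulo the line, [u] becomes a polynomial in the abscissa alone, and it vanishes at [x]. *)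
Lemma point_ideal_gen x l m u : point_ideal (Affine x (l * x + m)) u ->
  exists v w : A, u = v * coord_vert x + w * coord_line l m.
Proof.
rewrite /= => h.
have : root (u.1 + u.2 * (l%:P * 'X + m%:P)) x.
  by rewrite rootE !hornerE h.
move=> /factor_theorem[q eq].
exists (q, 0), (u.2, 0); rewrite !coord_mulE; apply/eqP.
rewrite -subr_eq0; apply/eqP; congr pair => /=; last by ring.
by rewrite !mul0r !addr0 -eq; ring.
Qed.

Lemma size_coord_normM u v : u != 0 -> v != 0 ->
  size (coord_norm (u * v)) = (size (coord_norm u) + size (coord_norm v)).-1.
Proof. by move=> u0 v0; rewrite coord_normM size_mul ?coord_norm_eq0. Qed.

Lemma size_norm_vert x : size (coord_norm (coord_vert x)) = 3%N.
Proof. by rewrite size_coord_norm size_XsubC size_poly0. Qed.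

Lemma size_norm_line y : size (coord_norm (coord_line 0 y)) = 4%N.
Proof.
rewrite size_coord_norm /= size_polyN mul0r add0r size_polyC size_poly1.
by case: (y == 0).
Qed.

Lemma coord_vert_neq0 x : coord_vert x != 0.
Proof. by rewrite -coord_norm_eq0 -size_poly_eq0 size_norm_vert. Qed.

Lemma coord_line_neq0 l m : coord_line l m != 0.
Proof. by apply/eqP => -[_ /eqP]; rewrite oner_eq0. Qed.

(** A nonzero element whose norm has size at most 2 is a constant, and a nonzero constant vanishes
    nowhere. *)
Lemma size_norm_affine x y u : u != 0 -> point_ideal (Affine x y) u ->
  (2 < size (coord_norm u))%N.
Proof.
move=> u0 /= h; rewrite ltnNge; apply/negP => le.
have : size u.2 = 0%N.
  by move: le; rewrite size_coord_norm; case: eqP => //=; lia.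
move/eqP; rewrite size_poly_eq0 => /eqP u20.
have : (size u.1 <= 1)%N.
  by move: le; rewrite size_coord_norm u20 size_poly0 /= maxn0; lia.
move/size1_polyC => e.
move: h; rewrite u20 horner0 mul0r addr0 e hornerC => c0.
case/eqP: u0; move: u20 e; rewrite c0.
by case: (u) => ? ? /= -> ->.
Qed.

(** Otherwise the ideal of the point would have a single generator [g], dividing both the vertical
    (norm of degree 2) and a line (norm of degree 3). The norm of [g] has degree at least 2, hence
    exactly 2, and the cofactor of the line would have a norm of degree 1. *)
Lemma not_same_class_infinity x y :
  ~ same_class (point_ideal Infinity) (point_ideal (Affine x y)).
Proof.
move=> [a [b [a0 b0 h1 h2]]].
have [g Ig eg] := h1 1 I.
have vert_in : point_ideal (Affine x y) (coord_vert x).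
  by rewrite /= hornerXsubC subrr horner0 mul0r addr0.
have line_in : point_ideal (Affine x y) (coord_line 0 y).
  by rewrite /= !hornerE; ring.
have [h _ eh] := h2 _ vert_in; have [k _ ek] := h2 _ line_in.
rewrite mulr1 in eg; rewrite {}eg -!mulrA in eh ek.
have /(coord_mulI b0) {}eh := eh; have /(coord_mulI b0) {}ek := ek.
have g0 : g != 0.
  by apply: contraTneq (coord_vert_neq0 x) => g0; rewrite -eh g0 mul0r eqxx.
have h0 : h != 0.
  by apply: contraTneq (coord_vert_neq0 x) => h0; rewrite -eh h0 mulr0 eqxx.
have k0 : k != 0.
  by apply: contraTneq (coord_line_neq0 0 y) => k0; rewrite -ek k0 mulr0 eqxx.
have := size_norm_vert x; have := size_norm_line y.
have := size_norm_affine g0 Ig.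
rewrite -eh -ek !size_coord_normM //.
have : size (coord_norm k) != 2%N.
  by rewrite size_coord_norm; case: (eqVneq (size k.2)) => /=; lia.
have : size (coord_norm h) != 0%N by rewrite size_poly_eq0 coord_norm_eq0.
lia.
Qed.

(** Degrees of norms show that multiplying by [a / b] sends the vertical and the horizontal line at
    [P] to elements [g] and [k] of the same shapes. Their vanishing at [Q] then gives both
    coordinates. *)
Lemma same_class_inj P Q :
  same_class (point_ideal P) (point_ideal Q) -> P = Q.
Proof.
case: P => [|x y]; case: Q => [|z t] //.
- by move/not_same_class_infinity.
- by move/same_class_sym/not_same_class_infinity.
move=> [a [b [a0 b0 h1 h2]]].
have vert_in u v : point_ideal (Affine u v) (coord_vert u).
  by rewrite /= hornerXsubC subrr horner0 mul0r addr0.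
have line_in u v : point_ideal (Affine u v) (coord_line 0 v).
  by rewrite /= !hornerE; ring.
have [g Ig eg] := h1 _ (vert_in x y).
have [h Ih eh] := h2 _ (vert_in z t).
have [k Ik ek] := h1 _ (line_in x y).
have : a * coord_vert x != 0.
  by rewrite coord_mul_eq0 (negPf a0) coord_vert_neq0.
rewrite {1}eg coord_mul_eq0 (negPf b0) /= => g0.
have : b * coord_vert z != 0.
  by rewrite coord_mul_eq0 (negPf b0) coord_vert_neq0.
rewrite -{1}eh coord_mul_eq0 (negPf a0) /= => h0.
have : a * coord_line 0 y != 0.
  by rewrite coord_mul_eq0 (negPf a0) coord_line_neq0.
rewrite {1}ek coord_mul_eq0 (negPf b0) /= => k0.
have := size_norm_affine g0 Ig; have := size_norm_affine h0 Ih.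
have := congr1 (size \o coord_norm) eg.
have := congr1 (size \o coord_norm) eh.
have := congr1 (size \o coord_norm) ek.
rewrite /= !size_coord_normM ?coord_vert_neq0 ?coord_line_neq0 //.
rewrite !size_norm_vert size_norm_line => s1 s2 s3 s4 s5.
have sa : size (coord_norm a) != 0%N by rewrite size_poly_eq0 coord_norm_eq0.
have sb : size (coord_norm b) != 0%N by rewrite size_poly_eq0 coord_norm_eq0.
(* [p] and [q] are the sizes of the norms of [a] and [b]. A vertical has the least norm size in a
   point ideal, on either side, which forces [p = q]. *)
have arith (p q u v w : nat) : (p + 4).-1 = (q + w).-1 ->
    (p + v).-1 = (q + 3).-1 -> (p + 3).-1 = (q + u).-1 ->
    (2 < v)%N -> (2 < u)%N -> p != 0 -> q != 0 -> u = 3 /\ w = 4.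
  by lia.
have [sg sk] := arith _ _ _ _ _ s1 s2 s3 s4 s5 sa sb.
have : size g.2 = 0%N.
  by move: sg; rewrite size_coord_norm; case: (eqVneq (size g.2)) => /=; lia.
move/eqP; rewrite size_poly_eq0 => /eqP g20.
have /eqP/size_poly1P[c c0 ek2] : size k.2 = 1%N.
  by move: sk; rewrite size_coord_norm; case: (eqVneq (size k.2)) => /=; lia.
(* Eliminating [a] and [b]; comparing components then determines [g] and [k] up to the constant
   [c]. *)
have e : g * coord_line 0 y = k * coord_vert x.
  apply: (coord_mulI b0); apply: (coord_mulI a0).
  transitivity (b * g * (a * coord_line 0 y)); first by ring.
  by rewrite -eg ek; ring.
have e2 := congr1 snd e; have e1 := congr1 fst e.
rewrite !coord_mulE /= g20 ek2 !(mul0r, mulr0, addr0, mulr1, add0r) in e1 e2.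
move: Ig; rewrite /= g20 horner0 mul0r addr0 e2 hornerM hornerC hornerXsubC.
move/eqP; rewrite mulf_eq0 (negPf c0) subr_eq0 => /eqP zx; subst z.
have : k.1 = - (c * y)%:P.
  have x0 : 'X - x%:P != 0 :> {poly K} by rewrite polyXsubC_eq0.
  by apply: (mulIf x0); rewrite -e1 e2 polyCM; ring.
move: Ik => /= + ek1; rewrite ek1 ek2 hornerN !hornerC => /eqP.
rewrite addrC subr_eq0 => /eqP/(mulfI c0) ->; congr Affine.
Qed.
End CoordRing.

(** * Ideal classes turn the chord-and-tangent law into multiplication *)

Section Addition.
Variables (K : fieldType) (f : {poly K}).
Hypotheses (f_cubic : size f = 4%N) (f_sep : separable_poly f).
Hypothesis two_neq0 : 2 != 0 :> K.

Lemma cubicE : f = (f`_0)%:P + f`_1 *: 'X + f`_2 *: 'X^2 + f`_3 *: 'X^3.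
Proof.
by apply/polyP => i; rewrite -{1}(coefK f) f_cubic coef_poly !coefE;
  case: i => [|[|[|[|i]]]] /=; rewrite ?(mulr0, mulr1, addr0, add0r).
Qed.

Lemma horner_cubic x :
  f.[x] = f`_0 + f`_1 * x + f`_2 * x ^+ 2 + f`_3 * x ^+ 3.
Proof. by rewrite {1}cubicE !hornerE. Qed.

Lemma horner_deriv_cubic x :
  f^`().[x] = f`_1 + 2 * f`_2 * x + 3 * f`_3 * x ^+ 2.
Proof.
rewrite {1}cubicE !derivE !hornerE /=; ring.
Qed.

Lemma cubic_lead_neq0 : f`_3 != 0.
Proof.
by rewrite -[3%N]/(4.-1) -f_cubic -lead_coefE lead_coef_eq0 -size_poly_eq0 f_cubic.
Qed.

Lemma simple_root x : f.[x] = 0 -> f^`().[x] != 0.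
Proof. by move: f_sep; rewrite separable_poly.unlock => sep /eqP;
  exact: coprimep_root. Qed.

(* Vieta's relations for the abscissas of the three points on the line
   [y = l x + m]. *)
Variant on_line (l m x1 x2 x3 : K) : Prop :=
  OnLine of f`_2 - l ^+ 2 = - f`_3 * (x1 + x2 + x3)
    & f`_1 - 2 * l * m = f`_3 * (x1 * x2 + x1 * x3 + x2 * x3)
    & f`_0 - m ^+ 2 = - f`_3 * (x1 * x2 * x3).

Lemma on_line_poly l m x1 x2 x3 : on_line l m x1 x2 x3 ->
  f - (l%:P * 'X + m%:P) ^+ 2 =
  (f`_3)%:P * ('X - x1%:P) * ('X - x2%:P) * ('X - x3%:P).
Proof.
case=> /eqP; rewrite subr_eq => /eqP e2 /eqP; rewrite subr_eq => /eqP e1.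
move=> /eqP; rewrite subr_eq => /eqP e0.
rewrite {1}cubicE e0 e1 e2 -!mul_polyC.
rewrite ?(polyC_natr, polyCD, polyCB, polyCM, polyCN, polyC_exp); ring.
Qed.

(** Chord and tangent merge here: later arguments only see a line meeting the curve at [x1], [x2],
    [x3]. The formula for the third abscissa is the first Vieta relation; the others follow by
    solving for the lower coefficients of the cubic. The final disjunction records that [y1] is
    nonzero at a tangency. *)
Lemma ec_add_on_line x1 y1 x2 y2 : y1 ^+ 2 = f.[x1] -> y2 ^+ 2 = f.[x2] ->
  ~~ ((x1 == x2) && (y1 == - y2)) ->
  exists l m x3, [/\ ec_add f (Affine x1 y1) (Affine x2 y2) =
      Affine x3 (- (l * x3 + m)), y1 = l * x1 + m, y2 = l * x2 + m,
      on_line l m x1 x2 x3 & (x1 != x2) || (y1 != 0)].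
Proof.
move=> e1 e2 ne /=; rewrite (negPf ne).
set l := (if _ then _ else _); set x3 := (_ / _ - _ - _).
have a0 := cubic_lead_neq0.
exists l, (y1 - l * x1), x3.
have ex3 : f`_2 - l ^+ 2 = - f`_3 * (x1 + x2 + x3) by rewrite /x3; field.
have e23 : f`_2 = l ^+ 2 - f`_3 * (x1 + x2 + x3).
  by move/eqP: ex3; rewrite subr_eq => /eqP ->; ring.
clearbody x3; rewrite horner_cubic in e1; rewrite horner_cubic in e2.
have e0 : f`_0 = y1 ^+ 2 - (f`_1 * x1 + f`_2 * x1 ^+ 2 + f`_3 * x1 ^+ 3).
  by rewrite e1; ring.
have [ex|nx] := eqVneq x1 x2.
  subst x2; rewrite eqxx /= in ne.
  have y12 : y1 = y2.
    have : (y1 - y2) * (y1 + y2) = 0 by rewrite -subr_sqr e1 e2 subrr.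
    move/eqP; rewrite mulf_eq0 subr_eq0 addr_eq0 (negPf ne) orbF.
    by move/eqP.
  have y10 : y1 != 0.
    by apply: contraNneq ne => h; rewrite -y12 h oppr0.
  have el : 2 * y1 * l = f^`().[x1].
    by rewrite /l eqxx mulrC divfK // mulf_neq0.
  clearbody l; rewrite horner_deriv_cubic in el.
  have f1e : f`_1 = 2 * y1 * l - 2 * f`_2 * x1 - 3 * f`_3 * x1 ^+ 2.
    by rewrite el; ring.
  split; rewrite -?y12 ?y10 ?orbT //; first by congr Affine; ring.
  - by ring.
  - by ring.
  - by split=> //; rewrite ?e0 f1e e23; ring.
have dx : x2 - x1 != 0 by rewrite subr_eq0 eq_sym.
have el : l * (x2 - x1) = y2 - y1 by rewrite /l (negPf nx) divfK.
clearbody l.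
have e2y : y2 = y1 + l * (x2 - x1) by rewrite el; ring.
have f1e : f`_1 = l * (y1 + y2) -
    (f`_2 * (x1 + x2) + f`_3 * (x1 ^+ 2 + x1 * x2 + x2 ^+ 2)).
  apply: (mulIf dx).
  transitivity (y2 ^+ 2 - y1 ^+ 2 - (f`_2 * (x1 + x2) +
    f`_3 * (x1 ^+ 2 + x1 * x2 + x2 ^+ 2)) * (x2 - x1)).
    by rewrite e1 e2; ring.
  by rewrite e2y; ring.
split=> //; first by congr Affine; ring.
- by ring.
- by rewrite e2y; ring.
- by split=> //; rewrite ?e0 f1e e2y e23; ring.
Qed.

Lemma curve_opp P : curve f P -> curve f (ec_opp P).
Proof. by case: P => //= x y; rewrite sqrrN. Qed.

Lemma curve_add P Q : curve f P -> curve f Q -> curve f (ec_add f P Q).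
Proof.
case: P Q => [|x1 y1] [|x2 y2] // e1 e2.
have [/= ->//|ne] := boolP ((x1 == x2) && (y1 == - y2)).
have [l [m [x3 [-> _ _ /on_line_poly /(congr1 (horner^~ x3)) /eqP]]]] :=
  ec_add_on_line e1 e2 ne.
by rewrite !hornerE subrr mulr0 subr_eq0 => /eqP /= ->; rewrite sqrrN.
Qed.

Local Notation Id := (@point_ideal K f).

Lemma ideal_mulAC (I J L : coord_ring f -> Prop) u :
  ideal_mul I (ideal_mul J L) u -> ideal_mul (ideal_mul I J) L u.
Proof.
by move=> /ideal_mulC/ideal_mulA/ideal_mulC/ideal_mulA/ideal_mulC.
Qed.

(** The product is the principal ideal of the vertical at [x]. One inclusion is
    [(Y - y)(Y + y) = f(X) - f(x)]. For the other, if [y] is nonzero the lines [Y - y] and [Y + y]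
    differ by the unit [2 y]; if [y = 0], then [f = h (X - x)] with [h(x)] nonzero because the root
    is simple, and [h - h(x)] only contributes a multiple of the squared vertical. *)
Lemma class_add_opp x y : y ^+ 2 = f.[x] -> same_class
  (ideal_mul (Id (Affine x y)) (Id (Affine x (- y)))) (Id Infinity).
Proof.
move=> e; exists 1, (coord_vert f x); split; rewrite ?oner_neq0 //.
- exact: coord_vert_neq0.
- have [h hE] : exists h, f - (f.[x])%:P = h * ('X - x%:P).
    by apply/factor_theorem; rewrite rootE !hornerE subrr.
  move=> u /(_ (fun u => exists2 v, Id Infinity v & 1 * u = coord_vert f x * v)).
  apply.
    move=> v w [v' _ ev] [w' _ ew]; exists (v' + w') => //.
    by rewrite !mulrDr ev ew.
  move=> i j; rewrite -[X in Affine x X](addr0 y) -(mul0r x) addrC => Ii.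
  rewrite -(addr0 (- y)) -(mul0r x) addrC => Ij.
  have [p [q ->]] := point_ideal_gen Ii; have [r [s ->]] := point_ideal_gen Ij.
  exists (p * r * coord_vert f x + p * s * coord_line f 0 (- y)
    + q * r * coord_line f 0 y + q * s * coord_poly f h) => //.
  have lE : coord_line f 0 y * coord_line f 0 (- y) = coord_poly f h *
    coord_vert f x.
    rewrite !coord_mulE; congr pair => /=; last by ring.
    rewrite -hE -e ?(polyCD, polyCB, polyCM, polyCN, polyC_exp); ring.
  transitivity (p * r * coord_vert f x ^+ 2
    + p * s * coord_line f 0 (- y) * coord_vert f x
    + q * r * coord_line f 0 y * coord_vert f x
    + q * s * (coord_line f 0 y * coord_line f 0 (- y))); first by ring.
  by rewrite lE; ring.
have [_ _ IM] : is_ideal (ideal_mul (Id (Affine x y)) (Id (Affine x (- y)))).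
  by apply: is_ideal_mul; apply: is_ideal_point; rewrite /= ?sqrrN.
have vert_in z : Id (Affine x z) (coord_vert f x).
  by rewrite /= !hornerE; ring.
have line_in z : Id (Affine x z) (coord_line f 0 z).
  by rewrite /= !hornerE; ring.
move=> u _; exists (coord_vert f x * u); last by rewrite mul1r.
rewrite mulrC; apply: (IM _ _).
have constM c w : coord_const f c * w = (c *: w.1, c *: w.2).
  by rewrite coord_mulE /= !mul0r !addr0 !mul_polyC.
have [y0|y0] := eqVneq y 0; last first.
  have y20 : 2 * y != 0 by rewrite mulf_neq0.
  have -> : coord_vert f x = coord_const f (- (2 * y)^-1) *
      (coord_line f 0 y * coord_vert f x)
    + coord_const f (2 * y)^-1 * (coord_vert f x * coord_line f 0 (- y)).
    rewrite !constM !coord_mulE; congr pair => /=; rewrite -!mul_polyC; last first.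
      by rewrite polyCN; ring.
    have c1 : (2 * y)^-1%:P * (2 * y%:P) = 1 :> {poly K}.
      by rewrite -polyC_natr -!polyCM mulVf.
    rewrite polyCN.
    transitivity ((2 * y)^-1%:P * (2 * y%:P) * ('X - x%:P));
      first by rewrite c1 mul1r.
    by rewrite !polyCN; ring.
  apply: ideal_mulD; apply: (IM _ _);
    first exact: ideal_mulP (line_in _) (vert_in _).
  exact: ideal_mulP (vert_in _) (line_in _).
subst y; have fx : f.[x] = 0 by rewrite -e expr0n.
have df := simple_root fx.
have [h hE] : exists h, f = h * ('X - x%:P).
  by apply/factor_theorem; rewrite rootE fx.
have hx : h.[x] = f^`().[x].
  by rewrite hE derivM hornerD !hornerM hornerXsubC derivXsubC !hornerE; ring.
have [k kE] : exists k, h - h.[x]%:P = k * ('X - x%:P).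
  by apply/factor_theorem; rewrite rootE !hornerE subrr.
have -> : coord_vert f x = coord_const f (h.[x])^-1 *
    (coord_line f 0 0 * coord_line f 0 (- 0)
     + coord_poly f (- k) * (coord_vert f x * coord_vert f x)).
  rewrite constM !coord_mulE; congr pair => /=; rewrite -!mul_polyC; last by ring.
  have c1 : (h.[x])^-1%:P * (h.[x])%:P = 1 :> {poly K}.
    by rewrite -polyCM mulVf // hx.
  transitivity ((h.[x])^-1%:P * (h.[x])%:P * ('X - x%:P)).
    by rewrite c1 mul1r.
  rewrite oppr0 polyC0 {1}hE.
  have -> : (h.[x])%:P = h - k * ('X - x%:P) by rewrite -kE; ring.
  by ring.
apply: (IM _ _); apply: ideal_mulD; first exact: ideal_mulP (line_in _) (line_in _).
by apply: (IM _ _); exact: ideal_mulP (vert_in _) (vert_in _).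
Qed.

(** The line through [P] and [Q] times its reflection is the leading coefficient times
    [(X - x1)(X - x2)(X - x3)]. Therefore the vertical at [x3] times the product ideal equals the
    line times the ideal of the sum. *)
Lemma class_add P Q : curve f P -> curve f Q ->
  same_class (ideal_mul (Id P) (Id Q)) (Id (ec_add f P Q)).
Proof.
have class0 S : curve f S -> forall u, ideal_mul (Id Infinity) (Id S) u <-> Id S u.
  move=> /(is_ideal_point)[_ ID IM] u; split.
    by apply=> // i j _; apply: (IM _ _).
  by move=> Su; rewrite -(mul1r u); exact: ideal_mulP.
move=> cP cQ; case: P cP => [|x1 y1] cP.
  by apply: same_class_eq => u; rewrite class0.
case: Q cQ => [|x2 y2] cQ.
  apply: same_class_eq => u.
  by rewrite -[X in _ <-> X](class0 (Affine x1 y1)) //; split; apply: ideal_mulC.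
have [/andP[/eqP e1 /eqP e2]|ne] := boolP ((x1 == x2) && (y1 == - y2)).
  have -> : ec_add f (Affine x1 y1) (Affine x2 y2) = Infinity.
    by rewrite /= e1 e2 !eqxx.
  by rewrite e1 e2 in cP *; have := class_add_opp cP; rewrite opprK.
have [l [m [x3 [-> yE1 yE2 /on_line_poly lE tang]]]] := ec_add_on_line cP cQ ne.
have lineE : coord_line f l m * coord_line' f l m = coord_const f (f`_3) *
    coord_vert f x1 * coord_vert f x2 * coord_vert f x3.
  rewrite !coord_mulE; congr pair => /=; last by ring.
  rewrite !(mul0r, mulr0, addr0) -lE; ring.
have a0 := cubic_lead_neq0.
have cV : coord_const f (f`_3)^-1 * coord_const f (f`_3) = 1.
  by rewrite coord_mulE /= !(mul0r, mulr0, addr0) -polyCM mulVf.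
have vert_in x z : Id (Affine x z) (coord_vert f x).
  by rewrite /= !(hornerD, hornerN, hornerM, hornerC, hornerX); ring.
have line_in x : Id (Affine x (l * x + m)) (coord_line f l m).
  by rewrite /= !(hornerD, hornerN, hornerM, hornerC, hornerX); ring.
have line_in' : Id (Affine x3 (- (l * x3 + m))) (coord_line' f l m).
  by rewrite /= !(hornerD, hornerN, hornerM, hornerC, hornerX); ring.
have [_ ID3 IM3] : is_ideal (Id (Affine x3 (- (l * x3 + m)))).
  apply: is_ideal_point => /=.
  have /eqP := congr1 (horner^~ x3) lE.
  by rewrite !hornerE subrr mulr0 subr_eq0 => /eqP ->; rewrite sqrrN.
have [_ _ IM] : is_ideal (ideal_mul (Id (Affine x1 y1)) (Id (Affine x2 y2))).
  by apply: is_ideal_mul; apply: is_ideal_point.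
exists (coord_vert f x3), (coord_line f l m); split.
- exact: coord_vert_neq0.
- exact: coord_line_neq0.
- move=> u /(_ (fun u => exists2 v, Id (Affine x3 (- (l * x3 + m))) v &
      coord_vert f x3 * u = coord_line f l m * v)); apply.
    move=> v w [v' hv ev] [w' hw ew]; exists (v' + w'); first exact: ID3.
    by rewrite !mulrDr ev ew.
  move=> i j; rewrite yE1 yE2 => /point_ideal_gen[p [q ->]].
  move=> /point_ideal_gen[r [s ->]].
  exists ((p * s * coord_vert f x1 + q * r * coord_vert f x2
     + q * s * coord_line f l m) * coord_vert f x3
     + p * r * coord_const f (f`_3)^-1 * coord_line' f l m).
    by apply: (ID3 _ _); apply: (IM3 _ _).
  transitivity (coord_line f l m * (p * s * coord_vert f x1
      + q * r * coord_vert f x2 + q * s * coord_line f l m) * coord_vert f x3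
      + p * r * (coord_const f (f`_3)^-1 * coord_const f (f`_3)) *
        coord_vert f x1 * coord_vert f x2 * coord_vert f x3).
    by rewrite cV; ring.
  transitivity (coord_line f l m * (p * s * coord_vert f x1
      + q * r * coord_vert f x2 + q * s * coord_line f l m) * coord_vert f x3
      + p * r * coord_const f (f`_3)^-1 *
        (coord_line f l m * coord_line' f l m)); last by ring.
  by rewrite lineE; ring.
(* The reverse inclusion needs the line itself in the product ideal. For a chord,
   [(X - x1) - (X - x2)] is a nonzero constant multiplying the line. *)
have lin : ideal_mul (Id (Affine x1 y1)) (Id (Affine x2 y2)) (coord_line f l m).
  have constM c w : coord_const f c * w = (c *: w.1, c *: w.2).
    by rewrite coord_mulE /= !mul0r !addr0 !mul_polyC.
  have constC c : (c^-1)%:P * c%:P = 1 :> {poly K} \/ c = 0.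
    by have [|c0] := eqVneq c 0; [right | left; rewrite -polyCM mulVf].
  have [x12|nx] := eqVneq x1 x2; last first.
    have -> : coord_line f l m = coord_const f (x2 - x1)^-1 *
      (coord_vert f x1 * coord_line f l m
        + coord_const f (-1) * (coord_vert f x2 * coord_line f l m)).
      case: (constC (x2 - x1)) => [c1|/eqP]; last first.
        by rewrite subr_eq0 eq_sym (negPf nx).
      have -> : coord_vert f x1 * coord_line f l m
        + coord_const f (-1) * (coord_vert f x2 * coord_line f l m)
        = coord_const f (x2 - x1) * coord_line f l m.
        rewrite !coord_mulE; congr pair => /=;
          rewrite ?(polyCB, polyCN, polyC1); ring.
      rewrite mulrA [coord_const f _ * coord_const f _]coord_mulE /=.
      by rewrite !(mul0r, mulr0, addr0) c1 mul1r.
    apply: (IM _ _); apply: ideal_mulD.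
      by rewrite yE2; exact: ideal_mulP (vert_in _ _) (line_in _).
    apply: (IM _ _); apply: ideal_mulC; rewrite yE1.
    exact: ideal_mulP (vert_in _ _) (line_in _).
  subst x2; rewrite -yE1 in yE2; subst y2; rewrite eqxx /= in tang.
  have y20 : 2 * y1 != 0 by rewrite mulf_neq0.
  (* For a tangent, [line * line' - line^2 = 2 (l X + m) line]; removing [2 l (X - x1) line] leaves
     [2 y1 line], and [y1] is nonzero. *)
  have -> : coord_line f l m = coord_const f (2 * y1)^-1 *
      (coord_const f (f`_3) * coord_vert f x3 * (coord_vert f x1 * coord_vert f x1)
       + coord_const f (-1) * (coord_line f l m * coord_line f l m)
       + coord_const f (- (2 * l)) * (coord_vert f x1 * coord_line f l m)).
    have -> : coord_const f (f`_3) * coord_vert f x3 *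
       (coord_vert f x1 * coord_vert f x1)
       = coord_line f l m * coord_line' f l m by rewrite lineE; ring.
    have -> : coord_line f l m * coord_line' f l m
       + coord_const f (-1) * (coord_line f l m * coord_line f l m)
       + coord_const f (- (2 * l)) * (coord_vert f x1 * coord_line f l m)
       = coord_const f (2 * y1) * coord_line f l m.
      rewrite !coord_mulE yE1; congr pair => /=;
        rewrite ?(polyC_natr, polyCD, polyCB, polyCM, polyCN, polyC1); ring.
    rewrite mulrA [coord_const f _ * coord_const f _]coord_mulE /=.
    case: (constC (2 * y1)) => [c1|/eqP]; last by rewrite (negPf y20).
    by rewrite !(mul0r, mulr0, addr0) c1 mul1r.
  have line_in1 := line_in x1; rewrite -yE1 in line_in1.
  have vert_in1 := vert_in x1 y1.
  by apply: (IM _ _); apply: ideal_mulD; first apply: ideal_mulD;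
    apply: (IM _ _); exact: ideal_mulP.
move=> w Iw.
have [p [q ->]] : exists p q, w = p * coord_vert f x3 + q * coord_line' f l m.
  have := @point_ideal_gen _ f x3 (- l) (- m) w.
  rewrite [- l * x3 - m](_ : _ = - (l * x3 + m)); last by ring.
  move=> /(_ Iw)[p [q ->]]; exists p, q; congr (_ + _ * _).
  by congr pair; rewrite !polyCN; ring.
exists (p * coord_line f l m + q * coord_const f (f`_3) *
     (coord_vert f x1 * coord_vert f x2)).
  apply: ideal_mulD; apply: (IM _ _) => //.
  exact: ideal_mulP (vert_in _ _) (vert_in _ _).
transitivity (p * coord_line f l m * coord_vert f x3
  + q * (coord_const f (f`_3) * coord_vert f x1 * coord_vert f x2 *
         coord_vert f x3)); first by ring.
by rewrite -lineE; ring.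
Qed.

Lemma ec_addC P Q : curve f P -> curve f Q -> ec_add f P Q = ec_add f Q P.
Proof.
move=> cP cQ; apply: (same_class_inj f_cubic).
apply: (same_class_trans f_cubic _ (class_add cQ cP)).
apply: (same_class_trans f_cubic (same_class_sym (class_add cP cQ))).
by apply: same_class_eq => u; split; apply: ideal_mulC.
Qed.

Lemma ec_addA P Q S : curve f P -> curve f Q -> curve f S ->
  ec_add f P (ec_add f Q S) = ec_add f (ec_add f P Q) S.
Proof.
move=> cP cQ cS; apply: (same_class_inj f_cubic).
have cPQ := curve_add cP cQ; have cQS := curve_add cQ cS.
apply: (same_class_trans f_cubic _ (class_add cPQ cS)).
apply: (same_class_trans f_cubic _ (same_class_mul _ (class_add cP cQ))).
apply: (same_class_trans f_cubic (same_class_sym (class_add cP cQS))).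
have mulC (I J : coord_ring f -> Prop) : same_class (ideal_mul I J) (ideal_mul J I).
  by apply: same_class_eq => u; split; apply: ideal_mulC.
apply: (same_class_trans f_cubic (mulC (Id P) (Id (ec_add f Q S)))).
apply: (same_class_trans f_cubic
  (same_class_mul (Id P) (same_class_sym (class_add cQ cS)))).
apply: same_class_eq => u; split => [/ideal_mulC/ideal_mulAC//|].
by move=> /ideal_mulA/ideal_mulC.
Qed.
End Addition.

(** * The abelian group of points *)

Section PointGroup.
Variable K : fieldType.

Definition point_code (P : Defs.point K) : option (K * K) :=
  if P is Affine x y then Some (x, y) else None.
Definition point_decode (u : option (K * K)) : Defs.point K :=
  if u is Some (x, y) then Affine x y else Infinity.
Fact point_codeK : cancel point_code point_decode.
Proof. by case. Qed.

HB.instance Definition _ := Choice.copy (Defs.point K) (can_type point_codeK).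

Record ecurve := ECurve {
  ec_poly :> {poly K};
  ec_cubic : size ec_poly = 4%N;
  ec_separable : separable_poly ec_poly;
  ec_char : 2 != 0 :> K }.

Variable E : ecurve.

Definition on_curve (P : Defs.point K) :=
  if P is Affine x y then y ^+ 2 == E.[x] else true.

Lemma on_curveP P : reflect (curve E P) (on_curve P).
Proof. by case: P => [|x y]; [apply: ReflectT | apply: eqP]. Qed.

Record ecp := ECP { ecp_val :> Defs.point K; _ : on_curve ecp_val }.

HB.instance Definition _ := [isSub for ecp_val].
HB.instance Definition _ := [Choice of ecp by <:].

Lemma ecpP (P : ecp) : curve E P.
Proof. by apply/on_curveP; case: P. Qed.

Definition ecp0 : ecp := @ECP Infinity isT.
Definition ecpN (P : ecp) : ecp :=
  ECP (introT (on_curveP _) (curve_opp (ecpP P))).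
Definition ecpD (P Q : ecp) : ecp := ECP (introT (on_curveP _)
  (curve_add (ec_cubic E) (ec_char E) (ecpP P) (ecpP Q))).

Fact ecpDA : associative ecpD.
Proof.
move=> P Q S; apply: val_inj.
exact: ec_addA (ec_cubic E) (ec_separable E) (ec_char E) _ _ _
  (ecpP P) (ecpP Q) (ecpP S).
Qed.
Fact ecpDC : commutative ecpD.
Proof.
move=> P Q; apply: val_inj.
exact: ec_addC (ec_cubic E) (ec_separable E) (ec_char E) _ _ (ecpP P) (ecpP Q).
Qed.
Fact ecpD0 : left_id ecp0 ecpD.
Proof. by move=> P; apply: val_inj. Qed.
Fact ecpDN : left_inverse ecp0 ecpN ecpD.
Proof. by move=> P; apply: val_inj; case: P => [] [|x y] //= _; rewrite !eqxx. Qed.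

HB.instance Definition _ := GRing.isZmodule.Build ecp ecpDA ecpDC ecpD0 ecpDN.

Lemma ecp_valD (P Q : ecp) : \val (P + Q) = ec_add E (\val P) (\val Q).
Proof. by []. Qed.

Definition mk_ecp x y (e : y ^+ 2 = E.[x]) : ecp :=
  ECP (introT (on_curveP (Affine x y)) e).

Variant ecp_spec : ecp -> Type :=
  | EcpInfinity : ecp_spec 0
  | EcpAffine x y (e : y ^+ 2 = E.[x]) : ecp_spec (mk_ecp e).

Lemma ecp_case (P : ecp) : ecp_spec P.
Proof.
case: P => [] [|x y] h.
  by rewrite (_ : ECP h = 0); [left | apply: val_inj].
have e : y ^+ 2 = E.[x] by apply/eqP.
by rewrite (_ : ECP h = mk_ecp e); [right | apply: val_inj].
Qed.

Lemma mk_ecp_inj x y (e : y ^+ 2 = E.[x]) z t (e' : t ^+ 2 = E.[z]) :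
  mk_ecp e = mk_ecp e' -> x = z /\ y = t.
Proof. by move=> /(congr1 (fun P : ecp => \val P)) [-> ->]. Qed.

Lemma mk_ecp_neq0 x y (e : y ^+ 2 = E.[x]) : mk_ecp e != 0.
Proof. by apply/eqP => /(congr1 (fun P : ecp => \val P)). Qed.

Lemma mk_ecp_opp x y (e : y ^+ 2 = E.[x]) z t (e' : t ^+ 2 = E.[z]) :
  (mk_ecp e == - mk_ecp e') = (x == z) && (y == - t).
Proof.
apply/eqP/andP => [/(congr1 (fun P : ecp => \val P)) [-> ->]|[/eqP ex /eqP ey]];
  by [rewrite !eqxx | apply: val_inj; rewrite /= ex ey].
Qed.

Lemma ecpD_on_line x1 y1 (e1 : y1 ^+ 2 = E.[x1]) x2 y2 (e2 : y2 ^+ 2 = E.[x2]) :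
  mk_ecp e1 != - mk_ecp e2 -> exists l m x3, exists e3 : (- (l * x3 + m)) ^+ 2
    = E.[x3],
  [/\ mk_ecp e1 + mk_ecp e2 = mk_ecp e3, y1 = l * x1 + m, y2 = l * x2 + m,
     on_line E l m x1 x2 x3 & (x1 != x2) || (y1 != 0)].
Proof.
rewrite mk_ecp_opp => ne.
have [l [m [x3 [eD l1 l2 ol t]]]] := ec_add_on_line (ec_cubic E) (ec_char E) e1
  e2 ne.
have e3 : (- (l * x3 + m)) ^+ 2 = E.[x3].
  by have := ecpP (mk_ecp e1 + mk_ecp e2);
    rewrite ecp_valD /= -/(ec_add E (Affine x1 y1) (Affine x2 y2)) eD.
by exists l, m, x3, e3; split=> //; apply: val_inj; rewrite ecp_valD.
Qed.
End PointGroup.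

(** * Circular groups and their torsion *)

(* A coordinate identifying a group with the circle [0, 1), wrap-around order
   included. *)
Record circular (R : realType) (A : zmodType) := Circular {
  angle :> A -> R;
  angle_inj : injective angle;
  angle_itv : forall p, 0 <= angle p < 1;
  angle_onto : forall r, 0 <= r < 1 -> exists p, angle p = r;
  angle0 : angle 0 = 0;
  angle_sub : forall p q, angle p <= angle q -> angle (q - p) <= angle q }.

(* The universal cover of the circle group: [(m, p)] sits at height [m + angle p]
   on the real line, and addition carries whenever the angles wrap around. *)
Definition lift (R : realType) (A : zmodType) (k : circular R A) : Type :=
  (int * A)%type.

Section Circular.
Variables (R : realType) (A : zmodType) (k : circular R A).

Lemma angle_ge0 p : 0 <= k p. Proof. by case/andP: (angle_itv k p). Qed.
Lemma angle_lt1 p : k p < 1. Proof. by case/andP: (angle_itv k p). Qed.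

(** On the standard circle [k (- q) = 1 - k q] for nonzero [q], so the test reads [k p + k q >= 1].
    It is phrased through the order because the angle is not assumed additive. *)
Definition carry p q := (q != 0) && (k (- q) <= k p).

Lemma carryE p q : carry p q = (k (p + q) < k p).
Proof.
apply/andP/idP => [[q0 le]|lt].
  have := angle_sub le; rewrite opprK le_eqVlt => /orP[/eqP/angle_inj/eqP|//].
  by rewrite -[X in _ == X]addr0 (inj_eq (addrI _)) (negPf q0).
split; first by apply: contraTneq lt => ->; rewrite addr0 ltxx.
by have := angle_sub (ltW lt); rewrite opprD addrA subrr add0r.
Qed.

Lemma carryC p q : carry p q = carry q p.
Proof.
suff imp x y : carry x y -> carry y x by apply/idP/idP; apply: imp.
rewrite !carryE => lt; rewrite [y + x]addrC ltNge; apply/negP => /angle_sub.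
by rewrite addrK leNgt lt.
Qed.

(** If the inequality failed, [(y - x) + (z - y)] would wrap around. So would [y + (z - y)], whose
    first summand has an angle at least as large, and then [k z < k y]. *)
Lemma angle_subl x y z : k x <= k y -> k y <= k z -> k (y - x) <= k (z - x).
Proof.
move=> xy yz; rewrite leNgt; apply/negP => lt.
have : carry (y - x) (z - y).
  by rewrite carryE addrAC addrCA subrr addr0 in lt *.
case/andP => d0 le; have : carry y (z - y).
  by rewrite /carry d0 (le_trans le) // angle_sub.
by rewrite carryE addrCA subrr addr0 ltNge yz.
Qed.

Lemma angle_subr x y z : k x <= k y -> k y <= k z -> k (z - y) <= k (z - x).
Proof.
move=> xy yz; have := angle_sub (angle_subl xy yz).
by rewrite opprB addrA subrK.
Qed.

(** The cocycle identity behind associativity of the cover, with [p] and [q] exchanged instead of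
    regrouped: commutativity makes the two forms equivalent, and the symmetry in [p] and [q] reduces
    the case analysis. *)
Lemma carry_comm x p q :
  (carry x p + carry (x + p)%R q = carry x q + carry (x + q)%R p)%N.
Proof.
have c0 y : carry y 0 = false by rewrite /carry eqxx.
have [->|p0] := eqVneq p 0; first by rewrite !c0 !addr0 addn0 add0n.
have [->|q0] := eqVneq q 0; first by rewrite !c0 !addr0 addn0 add0n.
wlog pq : p q p0 q0 / k (- p) <= k (- q).
  by move=> wl; case: (leP (k (- p)) (k (- q))) => [|/ltW] /wl ->.
rewrite /carry p0 q0 /=.
rewrite -{2}(opprK p) -{3}(opprK q).
(* [a] and [b] are thresholds: adding [p] to [x] wraps around exactly when [k a <= k x], and
   likewise for [q] and [b]. *)
move: (- p) (- q) p0 q0 pq => a b _ _ ab.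
have half u v : k u <= k x -> k v <= k x -> k v <= k (x - u) -> k u <= k (x - v).
  by move=> ux vx /angle_subr /(_ (angle_sub ux)); rewrite opprB addrC subrK.
have [ax|xa] := leP (k a) (k x); have [bx|xb] := leP (k b) (k x).
- suff -> : (k b <= k (x - a)) = (k a <= k (x - b)) by [].
  by apply/idP/idP; apply: half.
- rewrite [k b <= _]leNgt (le_lt_trans (angle_sub ax) xb) /=.
  suff -> : k a <= k (x - b) by [].
  rewrite leNgt; apply/negP => lt.
  have d0 : b - x != 0.
    by rewrite subr_eq0; apply: contraTneq xb => ->; rewrite ltxx.
  have : carry a (b - x) by rewrite /carry d0 opprB (ltW lt).
  rewrite carryC => /andP[a0 le].
  have : carry (b - a) a.
    by rewrite /carry a0 (le_trans le) // angle_subr // ltW.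
  by rewrite carryE subrK ltNge angle_sub.
- by have := le_lt_trans (le_trans ab bx) xa; rewrite ltxx.
- have far u v : k x < k u -> k x < k v -> k v <= k (x - u) -> k u <= k (x - v).
    move=> xu xv vy; rewrite leNgt; apply/negP => lt.
    have xxv : k x <= k (x - v).
      have := carryE x (- v); rewrite /carry opprK [k v <= _]leNgt xv andbF.
      by move/esym/negbT; rewrite -leNgt.
    have := angle_subr xxv (ltW lt).
    rewrite (_ : u - (x - v) = - (x - u - v));
      last by rewrite !opprB !addrA [u + v]addrC.
    rewrite -(opprB x u) => le.
    have w0 : x - u - v != 0.
      by rewrite addrAC subr_eq0; apply: contraTneq lt => ->; rewrite ltxx.
    have : carry (- (x - u)) (x - u - v) by rewrite /carry w0.
    rewrite carryC => /andP[_]; rewrite opprK => le2.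
    have /angle_inj/eqP : k (x - u - v) = k (x - u).
      by apply/le_anti; rewrite le2 angle_sub.
    rewrite -subr_eq0 addrAC subrr add0r oppr_eq0 => /eqP v0.
    by move: xv; rewrite v0 angle0 ltNge angle_ge0.
  suff -> : (k b <= k (x - a)) = (k a <= k (x - b)) by [].
  by apply/idP/idP; apply: far.
Qed.

Lemma carryA p q r :
  (carry p q + carry (p + q)%R r = carry q r + carry p (q + r)%R)%N.
Proof.
by rewrite [carry p q]carryC [p + q]addrC carry_comm [carry p (q + r)]carryC.
Qed.

Local Notation L := (lift k).

HB.instance Definition _ := Choice.copy L (int * A)%type.

Definition lift_add (g h : L) : L :=
  (g.1 + h.1 + (carry g.2 h.2)%:Z, g.2 + h.2).
(** The correction undoes the carry of [p + (- p)], which occurs unless [p] is 0. *)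
Definition lift_opp (g : L) : L := (- g.1 - (g.2 != 0)%:Z, - g.2).

Fact lift_addA : associative lift_add.
Proof.
move=> [m p] [n q] [l r]; rewrite /lift_add /=; congr pair; last exact: addrA.
have := carryA p q r; move: (carry p q) (carry (p + q) r) (carry q r).
by move: (carry p (q + r)) => [] [] [] [] //= _; ring.
Qed.
Fact lift_addC : commutative lift_add.
Proof.
by move=> [m p] [n q]; rewrite /lift_add /= carryC addrC [m + n]addrC [p + q]addrC
   [RHS]/= [_ + (n + m)]addrC.
Qed.
Fact lift_add0 : left_id ((0, 0) : L) lift_add.
Proof.
move=> [m p]; rewrite /lift_add /= carryC /carry eqxx /= !add0r.
by rewrite addr0.
Qed.
Fact lift_addN : left_inverse ((0, 0) : L) lift_opp lift_add.
Proof.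
move=> [m p]; rewrite /lift_add /lift_opp /= /carry lexx andbT addNr.
by congr pair; ring.
Qed.

HB.instance Definition _ :=
  GRing.isZmodule.Build L lift_addA lift_addC lift_add0 lift_addN.

Lemma lift_addE (g h : L) :
  g + h = (g.1 + h.1 + (carry g.2 h.2)%:Z, g.2 + h.2).
Proof. by []. Qed.

Lemma lift_muln2 (g : L) n : (g *+ n).2 = g.2 *+ n.
Proof. by elim: n => // n IH; rewrite !mulrS lift_addE /= IH. Qed.

(** An order isomorphism onto the real line that need not be additive; it imports completeness and
    density, while sums are controlled only through monotonicity. *)
Definition height (g : L) : R := g.1%:~R + k g.2.

Lemma height0 : height 0 = 0. Proof. by rewrite /height angle0 addr0. Qed.

Lemma height_lt g h :
  (height g < height h) = (g.1 < h.1) || (g.1 == h.1) && (k g.2 < k h.2).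
Proof.
case: g h => [m p] [n q]; rewrite /height /=.
have := angle_ge0 p; have := angle_ge0 q.
have := angle_lt1 p; have := angle_lt1 q.
have [lt|lt|->] := ltgtP m n => ? ? ? ?; last by rewrite ltrD2l.
  have : (m + 1)%:~R <= n%:~R :> R by rewrite ler_int; lia.
  by rewrite rmorphD /=; lra.
have : (n + 1)%:~R <= m%:~R :> R by rewrite ler_int; lia.
by rewrite rmorphD /=; lra.
Qed.

Lemma height_inj : injective height.
Proof.
move=> [m p] [n q] e; have := height_lt (m, p) (n, q); rewrite e ltxx /=.
have := height_lt (n, q) (m, p); rewrite e ltxx /=.
case: ltgtP => //= -> /esym/negbT; rewrite -leNgt => h1 /esym/negbT.
by rewrite -leNgt => h2; congr pair; apply/(@angle_inj _ _ k)/le_anti; rewrite h1.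
Qed.

Lemma height_onto r : exists g, height g = r.
Proof.
have [|p e] := @angle_onto _ _ k (r - (Num.floor r)%:~R).
  by have /andP := Num.Theory.floor_itv r; rewrite rmorphD /= => -[]; lra.
by exists (Num.floor r, p); rewrite /height /= e addrC subrK.
Qed.

(** This makes the cover an ordered group. If only the sum with [g] wraps around, the levels of [g]
    and [h] differ; when they differ by exactly one, the wrapped angle is below that of [t] and the
    unwrapped angle is not. *)
Lemma ltr_height t g h : height g < height h -> height (g + t) < height (h + t).
Proof.
case: g h t => [m p] [n q] [j s]; rewrite !height_lt !lift_addE /=.
have [/andP[s0 /= ps]|cp] := boolP (carry p s);
    have [/andP[_ /= qs]|cq] := boolP (carry q s).
- case/orP => [lt|/andP[/eqP -> pq]]; first by apply/orP; left; lia.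
  rewrite eqxx ltxx /= lt_neqAle (inj_eq (@angle_inj _ _ k)) (inj_eq (addIr s)).
  rewrite -(inj_eq (@angle_inj _ _ k)) (lt_eqF pq) /=.
  by have := angle_subl ps (ltW pq); rewrite opprK.
- case/orP => [lt|/andP[_ pq]]; last first.
    by move: cq; rewrite /carry s0 (le_trans ps (ltW pq)).
  have [e|ne] := eqVneq (m + 1) n; last by apply/orP; left; lia.
  apply/orP; right; apply/andP; split; first by lia.
  have : k (p + s) < k s by rewrite addrC -carryE carryC /carry s0.
  move/lt_le_trans; apply; rewrite leNgt addrC -carryE carryC; exact: cq.
- by case/orP => [lt|/andP[/eqP -> pq]]; apply/orP; left; lia.
- case/orP => [lt|/andP[/eqP -> pq]]; first by apply/orP; left; lia.
  rewrite eqxx ltxx /= ltNge; apply/negP => le.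
  have sq : k s <= k (q + s) by rewrite leNgt addrC -carryE carryC.
  by have := angle_subl sq le; rewrite !addrK leNgt pq.
Qed.

Lemma ler_height t g h :
  height g <= height h -> height (g + t) <= height (h + t).
Proof.
by rewrite le_eqVlt => /orP[/eqP/height_inj ->//|/(ltr_height t)/ltW].
Qed.

Lemma ltr_height_mul n g h : (0 < n)%N ->
  height g < height h -> height (g *+ n) < height (h *+ n).
Proof.
move=> n0 lt; case: n n0 => // n _; elim: n => // n IH.
rewrite mulrS [X in _ < height X]mulrS (lt_trans (ltr_height _ lt)) //.
by rewrite ![h + _]addrC ltr_height.
Qed.

Lemma ler_height_mul n g h :
  height g <= height h -> height (g *+ n) <= height (h *+ n).
Proof.
rewrite le_eqVlt => /orP[/eqP/height_inj ->//|lt].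
by case: n => [|n]; rewrite ?mulr0n // ltW // ltr_height_mul.
Qed.

Lemma height_sub_gt0 g h : (0 < height (h - g)) = (height g < height h).
Proof.
apply/idP/idP; first by rewrite -height0 => /(ltr_height g); rewrite add0r subrK.
by move/(ltr_height (- g)); rewrite subrr height0.
Qed.

Lemma lift_small d n : 0 < height d ->
  exists2 e, 0 < height e & height (e *+ n) <= height d.
Proof.
elim: n d => [|n IH] d d0.
  by exists d; rewrite // mulr0n height0 ltW.
(* Any [a] strictly between [0] and [d] serves; it need not be half of [d] in the group. The smaller
   of [d - a] and an [n]-th part fitting into [a] then fits [n + 1] times into [d]. *)
have [a ea] := height_onto (height d / 2).
have a0 : 0 < height a by lra.
have [e e0 le] := IH _ a0.
have b0 : 0 < height (d - a) by rewrite height_sub_gt0; lra.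
have [c [c0 ce cb]] : exists c, [/\ 0 < height c, height c <= height e
    & height c <= height (d - a)].
  case: (leP (height e) (height (d - a))) => h; first by exists e.
  by exists (d - a); split=> //; exact: ltW.
exists c => //; rewrite mulrS.
apply: le_trans (_ : height (d - a + c *+ n) <= _); first exact: ler_height.
rewrite -{2}(subrK a d) ![d - a + _]addrC; apply: ler_height.
exact: le_trans (ler_height_mul _ ce) le.
Qed.

(** One full turn, the generator of the kernel of the projection to [A]. *)
Definition lift1 : L := (1, 0).

Lemma lift1M m : lift1 *+ m = (m%:Z, 0).
Proof.
elim: m => // m IH; rewrite mulrS IH lift_addE /= /carry eqxx /= !addr0.
by rewrite -intS.
Qed.

Lemma height1 : height lift1 = 1. Proof. by rewrite /height angle0 addr0. Qed.

(** [b] is the supremum of the elements whose [n]-fold multiple is at most a full turn. If [b *+ n]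
    fell short, a small [e] could be added to [b]; if it went beyond, [b - e] would still bound the
    set. [lift_small] supplies [e]. *)
Lemma lift_divide n : (0 < n)%N -> exists b, b *+ n = lift1.
Proof.
move=> n0; pose S := [set r | exists2 g, height g = r & height (g *+ n) <=
  1]%classic.
have hS : has_sup S.
  split; first by exists 0, 0; rewrite ?mul0rn height0.
  exists 1 => _ [g <-]; case: (leP (height g) 1) => // lt.
  rewrite leNgt => /negP[]; rewrite -(prednK n0) mulrS.
  apply: (lt_le_trans lt); rewrite -{1}(add0r g) [g + _]addrC; apply: ler_height.
  have := @ler_height_mul n.-1 0 g; rewrite mul0rn height0; apply.
  exact: le_trans ler01 (ltW lt).
have [b eb] := height_onto (sup S); exists b; apply: height_inj.
have [lt|gt|//] := ltgtP (height (b *+ n)) (height lift1).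
- rewrite -height_sub_gt0 in lt; have [e e0 le] := lift_small n lt.
  have : height (b + e) <= height b.
    rewrite eb; apply: ub_le_sup; first by case: hS.
    exists (b + e) => //; rewrite -height1 mulrnDl addrC.
    by have := ler_height (b *+ n) le; rewrite subrK.
  by have := @ltr_height b 0 e; rewrite add0r height0 addrC leNgt => ->.
- rewrite -height_sub_gt0 in gt; have [e e0 le] := lift_small n gt.
  have lb : height (b - e) < height b.
    have := @ltr_height (b - e) 0 e.
    by rewrite add0r height0 addrCA subrr addr0; apply.
  have e' : 0 < sup S - height (b - e) by rewrite -eb; lra.
  have [_ [g <- gS]] := sup_adherent e' hS.
  rewrite opprB addrCA subrr addr0 => /(ltr_height_mul n0).
  rewrite ltNge => /negP[]; apply: (le_trans gS); rewrite -height1 mulrnBl.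
  by have := ler_height (lift1 - e *+ n) le; rewrite addrCA subrr addr0 addrA subrK.
Qed.

Lemma lift_torsion_free n (g : L) : (0 < n)%N -> g *+ n = 0 -> g = 0.
Proof.
move=> n0 gn; apply: height_inj; have [lt|gt|//] := ltgtP (height g) (height 0).
  by have := ltr_height_mul n0 lt; rewrite gn mul0rn ltxx.
by have := ltr_height_mul n0 gt; rewrite gn mul0rn ltxx.
Qed.

(** [B] is the image of the [n]-th part [b] of a full turn. A multiple of [b] projecting to 0 is a
    whole number of turns, hence a multiple of [b *+ n]. If [P] is [n]-torsion, then [n] times its
    lift is [m] turns, that is [n] times [b *+ m], and the cover is torsion-free. *)
Lemma circular_torsion n : (0 < n)%N -> exists B : A,
  (forall j, (B *+ j == 0) = (n %| j)%N) /\
  (forall P, P *+ n = 0 -> exists m, P = B *+ m).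
Proof.
move=> n0; have [b bn] := lift_divide n0; exists b.2.
have lift0 (g : L) : 0 <= height g -> g.2 = 0 -> exists m, g = lift1 *+ m.
  case: g => m p /= + p0; rewrite /height /= p0 angle0 addr0 ler0z.
  by case: m => // m _; exists m; rewrite lift1M.
have b0 : 0 < height b.
  rewrite ltNge; apply/negP => le; have := ler_height_mul n (h := 0).
  rewrite mul0rn => /(_ b); rewrite height0 => /(_ le).
  by rewrite bn height1; lra.
split=> [j|P Pn].
  apply/idP/idP => [/eqP Bj|/dvdnP[q ->]]; last first.
    by rewrite mulnC mulrnA -lift_muln2 bn mul0rn.
  have [||m e] := lift0 (b *+ j).
  - by have := ler_height_mul j (g := 0) (h := b); rewrite mul0rn height0;
      apply; exact: ltW.
  - by rewrite lift_muln2.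
  rewrite -bn -mulrnA in e; apply/dvdnP; exists m; rewrite mulnC.
  have le i l : b *+ i = b *+ l -> (i <= l)%N.
    move=> eil; rewrite leqNgt; apply/negP => lt.
    have : b *+ (i - l) = 0 by rewrite mulrnBr 1?ltnW // eil subrr.
    by move/lift_torsion_free => b00; rewrite b00 ?subn_gt0 // height0 ltxx in b0.
  by apply/eqP; rewrite eqn_leq !le.
pose g : L := (0, P).
have [||m e] := lift0 (g *+ n).
- have := @ler_height_mul n 0 g; rewrite mul0rn height0; apply.
  by rewrite /height /= add0r angle_ge0.
- by rewrite lift_muln2.
exists m; rewrite -lift_muln2; suff -> : b *+ m = g by [].
apply/esym/eqP; rewrite -subr_eq0; apply/eqP; apply: (lift_torsion_free n0).
by rewrite mulrnBl e -mulrnA mulnC mulrnA bn subrr.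
Qed.
End Circular.

(** * The circle of real points *)

(** The half-plane [x >= 0] cuts out the component of infinity, with exactly two points above each
    [x > 0]. The coefficient [nc_d] is the derivative at the root 0. *)
Record normal_curve (R : realType) := NormalCurve {
  nc_curve :> ecurve R;
  nc_b : R;
  nc_d : R;
  nc_polyE : nc_curve = 'X^3 + nc_b *: 'X^2 + nc_d *: 'X :> {poly R};
  nc_d_gt0 : 0 < nc_d;
  nc_pos : forall x, 0 < x -> 0 < x ^+ 2 + nc_b * x + nc_d }.

Section NormalCurve.
Variables (R : realType) (E : normal_curve R).
Local Notation b := (nc_b E).
Local Notation d := (nc_d E).
Local Notation d_gt0 := (nc_d_gt0 E).

Lemma nc_horner x : E.[x] = x * (x ^+ 2 + b * x + d).
Proof. by rewrite nc_polyE !(hornerD, hornerZ, hornerXn, hornerX); ring. Qed.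

Lemma nc_on_line l m x1 x2 x3 : on_line E l m x1 x2 x3 ->
  [/\ l ^+ 2 = x1 + x2 + x3 + b, d - 2 * l * m = x1 * x2 + x1 * x3 + x2 * x3
    & m ^+ 2 = x1 * x2 * x3].
Proof.
have [c0 c1 c2 c3] : [/\ E`_0 = 0, E`_1 = d, E`_2 = b & E`_3 = 1].
  by split; rewrite nc_polyE !coefE /= ?(mulr0, mulr1, addr0, add0r).
by case; rewrite c0 c1 c2 c3 => e1 e2 e3; split; [lra | rewrite e2; ring | lra].
Qed.

Lemma nc_y0 x y : 0 <= x -> y ^+ 2 = E.[x] -> (y == 0) = (x == 0).
Proof.
rewrite nc_horner le_eqVlt => /orP[/eqP <-|x0] e.
  by rewrite eqxx -sqrf_eq0 e mul0r eqxx.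
by rewrite -sqrf_eq0 e (gt_eqF x0) gt_eqF // mulr_gt0 ?nc_pos.
Qed.

Definition identity_component : {pred ecp E} := fun P =>
  if \val P is Affine x y then 0 <= x else true.

(** By Vieta [m ^ 2 = x1 * x2 * x3], so the third abscissa is nonnegative when the other two are
    positive. If one of them is 0, the line passes through the origin, [m = 0], and [d] is the
    product of the remaining two abscissas. *)
Fact identity_component_closed : zmod_closed identity_component.
Proof.
suff add P Q : P \in identity_component -> Q \in identity_component ->
    P + Q \in identity_component.
  by split=> // P Q hP hQ; apply: add => //; case: (ecp_case Q) hQ.
case: (ecp_case P) => [|x1 y1 e1]; first by rewrite add0r.
case: (ecp_case Q) => [|x2 y2 e2]; first by rewrite addr0.
move=> x10 x20; have {}x10 : 0 <= x1 := x10; have {}x20 : 0 <= x2 := x20.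
have [->|ne] := eqVneq (mk_ecp e1) (- mk_ecp e2); first by rewrite addNr.
have [l [m [x3 [e3 [-> l1 l2 /nc_on_line[_ h1 h0] _]]]]] := ecpD_on_line ne.
rewrite unfold_in /=; have d0 := d_gt0.
have [x1e|x1n] := eqVneq x1 0.
  have /eqP y1e : y1 == 0 by rewrite (nc_y0 x10 e1) x1e.
  by move: l1 h1; rewrite y1e x1e => l1 h1; nra.
have [x2e|x2n] := eqVneq x2 0.
  have /eqP y2e : y2 == 0 by rewrite (nc_y0 x20 e2) x2e.
  by move: l2 h1; rewrite y2e x2e => l2 h1; nra.
have x12 : 0 < x1 * x2 by rewrite mulr_gt0 // lt_neqAle eq_sym ?x1n ?x2n.
by rewrite -(pmulr_rge0 _ x12) -h0 sqr_ge0.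
Qed.

HB.instance Definition _ := GRing.isZmodClosed.Build (ecp E)
  identity_component identity_component_closed.

(** Every double lies in the component, since [m ^ 2 = x ^ 2 * x3] for a tangent, and a point of odd
    torsion is the opposite of a double. *)
Lemma odd_torsion_identity_component n (P : ecp E) :
  odd n -> P *+ n = 0 -> P \in identity_component.
Proof.
have dbl (Q : ecp E) : Q + Q \in identity_component.
  case: (ecp_case Q) => [|x y e]; first by rewrite addr0.
  have [{1}->|ne] := eqVneq (mk_ecp e) (- mk_ecp e); first by rewrite addNr.
  have [l [m [x3 [e3 [-> l1 l2 /nc_on_line[_ h1 h0] _]]]]] := ecpD_on_line ne.
  rewrite unfold_in /=; have [x0|x0] := eqVneq x 0.
    by move: ne; rewrite mk_ecp_opp eqxx -addr_eq0 /= -mulr2n mulrn_eq0 /=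
      (nc_y0 _ e) ?x0 ?eqxx.
  have x12 : 0 < x * x by rewrite -expr2 exprn_even_gt0.
  by rewrite -(pmulr_rge0 _ x12) -h0 sqr_ge0.
move=> n_odd; rewrite -(odd_double_half n) n_odd -addnn add1n mulrS mulrnDr.
by move=> /eqP; rewrite addr_eq0 => /eqP ->; rewrite rpredN.
Qed.

Record component := Component
  { component_val : ecp E; _ : component_val \in identity_component }.
HB.instance Definition _ := [isSub for component_val].
HB.instance Definition _ := [Choice of component by <:].
HB.instance Definition _ := [SubChoice_isSubZmodule of component by <:].

(** A convenient decreasing bijection from [[0, +oo)] onto [(0, 1/2]]. Infinity will have angle 0,
    the upper half descends to the origin at angle 1/2, and the lower half gets the reflected
    angles. *)
Definition half_angle (x : R) := (2 * (1 + x))^-1.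

Lemma half_angle0 : half_angle 0 = 1 / 2.
Proof. by rewrite /half_angle addr0 mulr1 div1r. Qed.

Lemma half_angle_lt x z : 0 <= x -> 0 <= z ->
  (half_angle x < half_angle z) = (z < x).
Proof. by move=> x0 z0; rewrite /half_angle ltf_pV2 ?posrE //;
  [apply/idP/idP|..]; lra. Qed.

Lemma half_angle_itv x : 0 <= x -> 0 < half_angle x <= 1 / 2.
Proof.
move=> x0; rewrite /half_angle invr_gt0 div1r lef_pV2 ?posrE; lra.
Qed.

Lemma half_angle_inj x z : 0 <= x -> 0 <= z -> half_angle x = half_angle z -> x = z.
Proof. by move=> x0 z0 /invr_inj; lra. Qed.

Definition ecp_angle (P : ecp E) : R :=
  if \val P is Affine x y then
    if 0 <= y then half_angle x else 1 - half_angle x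
  else 0.
Definition point_angle (P : component) : R := ecp_angle (\val P).

(* The chord from [Q] to [- P] crosses the axis at some [x0] between their
   abscissas, where the cubic is positive; this places its third point to the
   right of [x0]. *)
Lemma chord_monotone x1 y1 (e1 : y1 ^+ 2 = E.[x1]) x2 y2 (e2 : y2 ^+ 2 = E.[x2]) :
  0 < y1 -> 0 <= y2 -> 0 <= x2 -> x2 < x1 ->
  exists x3 y3 (e3 : y3 ^+ 2 = E.[x3]),
    [/\ mk_ecp e2 - mk_ecp e1 = mk_ecp e3, 0 < y3 & x2 < x3].
Proof.
move=> y10 y20 x20 x21.
have e1' : (- y1) ^+ 2 = E.[x1] by rewrite sqrrN.
have -> : - mk_ecp e1 = mk_ecp e1' by apply: val_inj.
have ne : mk_ecp e2 != - mk_ecp e1' by rewrite mk_ecp_opp lt_eqF.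
have [l [m [x3 [e3 [eD l2 l1 ol _]]]]] := ecpD_on_line ne.
exists x3, (- (l * x3 + m)), e3.
have [_ h1 h0] := nc_on_line ol.
have l_lt0 : l < 0 by nra.
have d0 := d_gt0.
(* Here the chord meets the axis at the origin itself, where the cubic is 0; instead [d = x1 * x3]
   gives the sign of [x3]. *)
have [x2e|x2n] := eqVneq x2 0.
  have /eqP y2e : y2 == 0 by rewrite (nc_y0 x20 e2) x2e.
  have m0 : m = 0 by move: l2; rewrite y2e x2e; lra.
  have x30 : 0 < x3 by move: h1; rewrite x2e m0; nra.
  by split=> //; [rewrite m0; nra | rewrite x2e].
have x2_gt0 : 0 < x2 by rewrite lt_neqAle eq_sym x2n.
have y2_gt0 : 0 < y2 by rewrite lt_neqAle eq_sym (nc_y0 x20 e2) x2n.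
pose x0 := - m / l.
have lx0 : l * x0 = - m by rewrite /x0 mulrC divfK // lt_eqF.
have x0_lt : x2 < x0 by nra.
have x0_gt : x0 < x1 by nra.
have fx0 : E.[x0] = (x0 - x2) * (x0 - x1) * (x0 - x3).
  have lead1 : E`_3 = 1 by rewrite nc_polyE !coefE /= ?(mulr0, mulr1, addr0).
  have /(congr1 (horner^~ x0)) := on_line_poly (ec_cubic E) ol.
  rewrite lead1 !(hornerD, hornerN, hornerM, hornerXsubC, hornerX, hornerC,
    horner_exp).
  by rewrite lx0 addNr ?expr0n ?mul0r /= subr0 => ->; ring.
have fx0_gt0 : 0 < E.[x0].
  by rewrite nc_horner mulr_gt0 ?nc_pos; lra.
have x03 : x0 < x3.
  have : 0 < (x0 - x2) * (x1 - x0) by apply: mulr_gt0; lra.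
  by nra.
by split=> //; [nra | lra].
Qed.

Fact point_angle_itv P : 0 <= point_angle P < 1.
Proof.
case: P => P; rewrite /point_angle /ecp_angle /=; case: (ecp_case P) => [|x y e] hP.
  by rewrite /= lexx ltr01.
have {hP} := half_angle_itv (hP : 0 <= x); rewrite /=; case: ifP => _; lra.
Qed.

Fact point_angle0 : point_angle 0 = 0. Proof. by []. Qed.

Fact point_angle_inj : injective point_angle.
Proof.
case=> P hP [Q hQ]; rewrite /point_angle /ecp_angle /= => e; apply: val_inj => /=.
move: hP hQ e; case: (ecp_case P) => [|x1 y1 e1];
  case: (ecp_case Q) => [|x2 y2 e2] //.
- move=> _ hQ e; exfalso; move: e; have x20 : 0 <= x2 := hQ;
    have {hQ} := half_angle_itv x20.
  by rewrite /=; case: ifP; lra.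
- move=> hP _ e; exfalso; move: e; have x10 : 0 <= x1 := hP;
    have {hP} := half_angle_itv x10.
  by rewrite /=; case: ifP; lra.
move=> x10 x20 /= e; have {}x10 : 0 <= x1 := x10; have {}x20 : 0 <= x2 := x20.
have i1 := half_angle_itv x10; have i2 := half_angle_itv x20.
have y0 x y : 0 <= x -> y ^+ 2 = E.[x] -> y < 0 -> half_angle x < 1 / 2.
  move=> x0 ey yl; rewrite -half_angle0 half_angle_lt //.
  by rewrite lt_neqAle x0 eq_sym -(nc_y0 x0 ey) lt_eqF.
have ex : x1 = x2.
  apply: half_angle_inj => //; move: e; case: (leP 0 y1) => h1;
    case: (leP 0 y2) => h2.
  - by [].
  - by have := y0 _ _ x20 e2 h2; lra.
  - by have := y0 _ _ x10 e1 h1; lra.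
  - by lra.
have : y1 ^+ 2 = y2 ^+ 2 by rewrite e1 e2 ex.
move/eqP; rewrite eqf_sqr => /orP[] /eqP ey.
  by apply: val_inj; rewrite /= ex ey.
suff y10 : y1 == 0 by apply: val_inj; rewrite /= ex -[y2]opprK -ey (eqP y10) oppr0.
apply: contraT => yn.
move: e; rewrite ex; case: (leP 0 y1) => h1; case: (leP 0 y2) => h2.
- by move: yn; rewrite (_ : y1 = 0) ?eqxx //; lra.
- by have := y0 _ _ x20 e2 h2; lra.
- by have := y0 _ _ x10 e1 h1; rewrite ex; lra.
- by lra.
Qed.

Fact point_angle_onto r : 0 <= r < 1 -> exists P, point_angle P = r.
Proof.
move=> /andP[]; rewrite le_eqVlt => /orP[/eqP <-|r0] r1; first by exists 0.
have upper s : 0 < s -> s <= 1 / 2 -> exists2 x, 0 <= x & half_angle x = s.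
  move=> s0 s1; exists ((2 * s)^-1 - 1).
    rewrite subr_ge0 -[X in X <= _]invr1 lef_pV2 ?posrE; lra.
  by rewrite /half_angle; field; rewrite ?gt_eqF //; lra.
have root_ge0 x : 0 <= x -> 0 <= E.[x].
  rewrite nc_horner le_eqVlt => /orP[/eqP <-|x0]; first by rewrite mul0r.
  by rewrite mulr_ge0 ?ltW ?nc_pos.
have [r2|r2] := leP r (1 / 2).
  have [x x0 hx] := upper r r0 r2.
  have e : Num.sqrt E.[x] ^+ 2 = E.[x] by rewrite sqr_sqrtr ?root_ge0.
  by exists (@Component (mk_ecp e) x0);
    rewrite /point_angle /ecp_angle /= sqrtr_ge0.
have [||x x0 hx] := upper (1 - r); [lra..|].
have e : (- Num.sqrt E.[x]) ^+ 2 = E.[x] by rewrite sqrrN sqr_sqrtr ?root_ge0.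
exists (@Component (mk_ecp e) x0);
  rewrite /point_angle /ecp_angle /= oppr_ge0 leNgt.
suff -> : 0 < Num.sqrt E.[x] by rewrite /= hx; lra.
have x_gt0 : 0 < x.
  rewrite lt_neqAle x0 andbT; apply/eqP => x00.
  by move: hx; rewrite -x00 half_angle0; lra.
by rewrite sqrtr_gt0 nc_horner mulr_gt0 ?nc_pos.
Qed.

(** Cases by the halves containing the points. When both are in the upper half, [chord_monotone]
    puts [Q - P] there too, to the right of [Q]. When both are in the lower half, it applies to
    their opposites and puts [Q - P] in the upper half, hence before [Q]. [P] in the lower and [Q]
    in the upper half contradicts the hypothesis. *)
Fact point_angle_sub P Q :
  point_angle P <= point_angle Q -> point_angle (Q - P) <= point_angle Q.
Proof.
have [->|PQ] := eqVneq P Q.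
  by rewrite subrr point_angle0; have /andP[] := point_angle_itv Q.
have [P0|Pn] := eqVneq P 0; first by rewrite P0 subr0.
have [->|Qn] := eqVneq Q 0.
  rewrite point_angle0 => le; case/eqP: Pn; apply: point_angle_inj.
  by apply/le_anti; rewrite le; have /andP[] := point_angle_itv P.
case: P Q PQ Pn Qn => P hP [Q hQ]; rewrite -!val_eqE /=.
have -> : point_angle (Component hQ - Component hP) = ecp_angle (Q - P) by [].
rewrite /point_angle /=.
case: (ecp_case P) hP => [|x1 y1 e1]; first by rewrite eqxx.
case: (ecp_case Q) hQ => [|x2 y2 e2]; first by rewrite eqxx.
move=> x20 x10 PQ _ _; have {}x10 : 0 <= x1 := x10; have {}x20 : 0 <= x2 := x20.
have i1 := half_angle_itv x10; have i2 := half_angle_itv x20.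
have lt0 x y : 0 <= x -> y ^+ 2 = E.[x] -> y < 0 -> 0 < x.
  by move=> x0 ey yl; rewrite lt_neqAle x0 eq_sym -(nc_y0 x0 ey) lt_eqF.
have half_le x z : 0 <= x -> 0 <= z -> (half_angle x <= half_angle z) = (z <= x).
  by move=> x0 z0; rewrite leNgt half_angle_lt // -leNgt.
have neqx : 0 <= y1 * y2 -> x1 != x2.
  move=> y12; apply: contraNneq PQ => ex.
  have : y1 ^+ 2 == y2 ^+ 2 by rewrite e1 e2 ex.
  rewrite eqf_sqr => h; have ey : y1 = y2.
    case/orP: h => /eqP // h; have : y2 ^+ 2 = 0.
      by apply/le_anti; rewrite sqr_ge0 andbT; move: y12;
        rewrite h mulNr -expr2; lra.
    by move/eqP; rewrite sqrf_eq0 => /eqP y20; rewrite h y20 oppr0.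
  by rewrite /= ex ey.
have e1' : (- y1) ^+ 2 = E.[x1] by rewrite sqrrN.
have e2' : (- y2) ^+ 2 = E.[x2] by rewrite sqrrN.
have angleE x y (e : y ^+ 2 = E.[x]) : ecp_angle (mk_ecp e) =
  if 0 <= y then half_angle x else 1 - half_angle x by [].
have N1 : mk_ecp e1 = - mk_ecp e1' by apply: val_inj; rewrite /= opprK.
have N2 : mk_ecp e2 = - mk_ecp e2' by apply: val_inj; rewrite /= opprK.
rewrite !angleE; case: (leP 0 y1) => y10; case: (leP 0 y2) => y20.
- rewrite half_le // => x21.
  have {}x21 : x2 < x1 by rewrite lt_neqAle x21 eq_sym neqx ?mulr_ge0.
  have y1_gt0 : 0 < y1 by rewrite lt_neqAle y10 eq_sym (nc_y0 x10 e1) gt_eqF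
    //; lra.
  have [x3 [y3 [e3 [-> y30 x23]]]] := chord_monotone e1 e2 y1_gt0 y20 x20 x21.
  by rewrite angleE (ltW y30) half_le //; lra.
(* If [Q - P] came after [Q], its opposite [S] would lie in the upper half to the right of [- Q],
   and [chord_monotone] would put [- Q - S = - P] strictly in the upper half, although [y1 >= 0]. *)
- move=> _; rewrite N2 -opprD.
  move eS: (mk_ecp e2' + mk_ecp e1) => S.
  case: (ecp_case S) eS => [_|x3 y3 e3 eD].
    by rewrite oppr0 {1}/ecp_angle /=; lra.
  have e3' : (- y3) ^+ 2 = E.[x3] by rewrite sqrrN.
  have -> : - mk_ecp e3 = mk_ecp e3' by apply: val_inj.
  have x30 : 0 <= x3.
    suff : mk_ecp e3 \in identity_component by [].
    by rewrite -eD rpredD.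
  have i3 := half_angle_itv x30.
  rewrite angleE; case: (leP 0 (- y3)) => y30; first by lra.
  rewrite lerD2l lerN2 half_le // leNgt; apply/negP => x23.
  have y2_ge0 : 0 <= - y2 by lra. have y3_gt0 : 0 < y3 by lra.
  have [x4 [y4 [e4 [+ y40 _]]]] := chord_monotone e3 e2' y3_gt0 y2_ge0 x20 x23.
  rewrite -eD opprD addrA subrr add0r => /(congr1 (fun S : ecp E => \val S)) /=.
  by case=> _ y14; lra.
- have := half_angle_lt x10 (lexx 0); rewrite (lt0 x1 y1) // half_angle0.
  by lra.
- rewrite lerD2l lerN2 half_le // => x12.
  have {}x12 : x1 < x2.
    by rewrite lt_neqAle x12 neqx //; nra.
  have y1_ge0 : 0 <= - y1 by lra. have y2_gt0 : 0 < - y2 by lra.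
  have [x3 [y3 [e3 [+ y30 x13]]]] := chord_monotone e2' e1' y2_gt0 y1_ge0 x10 x12.
  rewrite N1 N2 opprK addrC => ->; rewrite angleE (ltW y30).
  have := half_angle_itv (ltW (le_lt_trans x10 x13)); lra.
Qed.

Definition component_circular : circular R component :=
  Circular point_angle_inj point_angle_itv point_angle_onto point_angle0
    point_angle_sub.

Lemma normal_odd_torsion n : odd n -> exists B : ecp E,
  (forall j, (B *+ j == 0) = (n %| j)%N) /\
  (forall P, P *+ n = 0 -> exists m, P = B *+ m).
Proof.
move=> n_odd; have [B [ordB genB]] := circular_torsion component_circular
  (odd_gt0 n_odd).
exists (\val B); split=> [j|P Pn]; first by rewrite -raddfMn /= -ordB -val_eqE.
have hP := odd_torsion_identity_component n_odd Pn.
have [|m e] := genB (Component hP); first by apply: val_inj; rewrite raddfMn.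
by exists m; rewrite -raddfMn -e.
Qed.
End NormalCurve.

(** * Affine changes of coordinates and normal forms *)

Section Transport.
Variables (K1 K2 : fieldType) (iota : {rmorphism K1 -> K2}).
Variables (E1 : ecurve K1) (E2 : ecurve K2) (al be ga : K2).
Hypotheses (al0 : al != 0) (be0 : be != 0).
Hypothesis E12 :
  be ^+ 2 *: map_poly iota E1 = E2 \Po (al *: 'X + ga%:P).

(** One map for two purposes: with [iota] the conjugation and trivial coefficients it is the action
    of conjugation on the complex curve; with [iota] the inclusion of the reals it embeds a normal
    curve. *)
Definition affine_map (P : Defs.point K1) : Defs.point K2 :=
  if P is Affine x y then Affine (al * iota x + ga) (be * iota y) else Infinity.

Lemma transport_horner x : be ^+ 2 * iota E1.[x] = E2.[al * iota x + ga].
Proof.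
have := congr1 (horner^~ (iota x)) E12.
rewrite hornerZ horner_map horner_comp => ->.
by rewrite !(hornerD, hornerZ, hornerX, hornerC).
Qed.

Lemma transport_deriv x :
  be ^+ 2 * iota E1^`().[x] = al * E2^`().[al * iota x + ga].
Proof.
have := congr1 (fun p => p^`().[iota x]) E12.
rewrite derivZ deriv_map hornerZ horner_map deriv_comp hornerM horner_comp => ->.
rewrite !derivE !(hornerD, hornerZ, hornerX, hornerC, hornerE) /=.
by rewrite mulrC.
Qed.

(** Besides the derivative, these are the coefficients that enter the addition law. *)
Lemma transport_coef :
  be ^+ 2 * iota E1`_3 = al ^+ 3 * E2`_3 /\
  be ^+ 2 * iota E1`_2 = al ^+ 2 * (3 * E2`_3 * ga + E2`_2).
Proof.
have e i : be ^+ 2 * iota E1`_i = (E2 \Po (al *: 'X + ga%:P))`_i.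
  by rewrite -E12 coefZ coef_map.
rewrite !e (cubicE (ec_cubic E2)).
set c0 := E2`_0; set c1 := E2`_1; set c2 := E2`_2; set c3 := E2`_3.
have -> : (c0%:P + c1 *: 'X + c2 *: 'X^2 + c3 *: 'X^3) \Po (al *: 'X + ga%:P) =
  (c0 + c1 * ga + c2 * ga ^+ 2 + c3 * ga ^+ 3)%:P
  + (al * (c1 + 2 * c2 * ga + 3 * c3 * ga ^+ 2)) *: 'X
  + (al ^+ 2 * (3 * c3 * ga + c2)) *: 'X^2 + (al ^+ 3 * c3) *: 'X^3.
  rewrite !(comp_polyD, comp_polyZ, comp_polyC, comp_polyX, comp_Xn_poly).
  rewrite -!mul_polyC ?(polyC_natr, polyCD, polyCM, polyC_exp); ring.
by rewrite !coefE /= !(mulr0, mulr1, addr0, add0r).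
Qed.

Lemma affine_mapD P Q :
  affine_map (ec_add E1 P Q) = ec_add E2 (affine_map P) (affine_map Q).
Proof.
case: P Q => [|x1 y1] [|x2 y2] //=.
have eqx u v : (al * iota u + ga == al * iota v + ga) = (u == v).
  by rewrite (inj_eq (addIr _)) (inj_eq (mulfI al0)) fmorph_eq.
have eqy u v : (be * iota u == - (be * iota v)) = (u == - v).
  by rewrite -mulrN -rmorphN (inj_eq (mulfI be0)) fmorph_eq.
rewrite eqx eqy; case: ifP => // ne.
have [c3 c2] := transport_coef.
have a0 := cubic_lead_neq0 (ec_cubic E1); have b0 := cubic_lead_neq0 (ec_cubic E2).
set l := (if x1 == x2 then _ else _); set l' := (if x1 == x2 then _ else _).
have el : l' = be / al * iota l.
  rewrite /l' /l; have [ex|nx] := eqVneq x1 x2.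
    have := transport_deriv x1; rewrite fmorph_div rmorphM rmorph_nat => dE.
    (* The points are not assumed to lie on the curve, so [y1 = 0] can occur; both slopes are then 0
       because division by 0 yields 0. *)
    have [->|y0] := eqVneq y1 0; first by rewrite rmorph0 !(mulr0, invr0).
    have y0' : iota y1 != 0 by rewrite fmorph_eq0.
    have two0 : 2 != 0 :> K2 := ec_char E2.
    have -> : E2^`().[al * iota x1 + ga] = be ^+ 2 * iota E1^`().[x1] / al.
      by apply: (mulfI al0); rewrite -dE; field.
    by field; rewrite ?al0 ?be0 ?two0 ?y0'.
  have x0 : iota x2 - iota x1 != 0 by rewrite -rmorphB fmorph_eq0 subr_eq0 eq_sym.
  rewrite fmorph_div !rmorphB /=; field; rewrite al0 x0 /=.
  have -> : al * iota x2 + ga - (al * iota x1 + ga) = al * (iota x2 - iota x1)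
    by ring.
  by rewrite mulf_neq0.
have x3E : al * iota ((l ^+ 2 - E1`_2) / E1`_3 - x1 - x2) + ga =
    (l' ^+ 2 - E2`_2) / E2`_3 - (al * iota x1 + ga) - (al * iota x2 + ga).
  rewrite el !rmorphB fmorph_div !rmorphB rmorphXn /=.
  have a0' : iota E1`_3 != 0 by rewrite fmorph_eq0.
  have -> : iota E1`_3 = al ^+ 3 * E2`_3 / be ^+ 2.
    by rewrite -c3; field.
  have -> : iota E1`_2 = al ^+ 2 * (3 * E2`_3 * ga + E2`_2) / be ^+ 2.
    by rewrite -c2; field.
  by field; rewrite ?al0 ?be0 ?b0.
congr Affine => //; rewrite -x3E el rmorphB rmorphM rmorphB.
by field; rewrite fmorph_eq0 a0 al0.
Qed.

Lemma affine_map_on_curve P : on_curve E1 P -> on_curve E2 (affine_map P).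
Proof.
case: P => //= x y /eqP e.
by rewrite exprMn -rmorphXn e transport_horner.
Qed.

Lemma transport : exists phi : {additive ecp E1 -> ecp E2},
  injective phi /\ forall P, \val (phi P) = affine_map (\val P).
Proof.
pose phi (P : ecp E1) : ecp E2 := ECP (affine_map_on_curve (valP P)).
have phi_add : zmod_morphism phi.
  move=> P Q; apply: val_inj; rewrite /= affine_mapD; congr ec_add.
  by case: (ecp_case Q) => //= x y _; rewrite rmorphN mulrN.
pose phiM := GRing.isZmodMorphism.Build _ _ phi phi_add.
pose phiA : {additive ecp E1 -> ecp E2} := HB.pack phi phiM.
exists phiA.
split=> // P Q /(congr1 (fun S : ecp E2 => \val S)) /=.
case: (ecp_case P) => [|x y e]; case: (ecp_case Q) => [|z t e'] //= [].
move=> /addIr/(mulfI al0)/fmorph_inj ex /(mulfI be0)/fmorph_inj ey.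
by apply: val_inj; rewrite /= ex ey.
Qed.
End Transport.

Lemma separable_affine (F : fieldType) (p : {poly F}) (c al ga : F) :
  c != 0 -> al != 0 -> separable_poly p ->
  separable_poly (c *: (p \Po (al *: 'X + ga%:P))).
Proof.
move=> c0 al0; rewrite !separable_poly.unlock derivZ deriv_comp => sep.
rewrite coprimepZl // coprimepZr // !derivE -mul_polyC mulr1 addr0.
by rewrite mulrC mul_polyC coprimepZr //; exact: coprimep_comp_poly.
Qed.

(** * Normal forms of a real cubic and of its quadratic twist *)

Section NormalForm.
Variables (R : realType) (f : {poly R}).
Hypotheses (f_cubic : size f = 4%N) (f_sep : separable_poly f).

Fact real_two_neq0 : 2 != 0 :> R.
Proof. by rewrite pnatr_eq0. Qed.

(** Taylor expansion at the root [e]; the quadratic coefficient involves half the second derivative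
    there. *)
Lemma comp_at_root e al : f.[e] = 0 ->
  f \Po (al *: 'X + e%:P) = (f`_3 * al ^+ 3) *: 'X^3
    + ((3 * f`_3 * e + f`_2) * al ^+ 2) *: 'X^2 + (f^`().[e] * al) *: 'X.
Proof.
move=> fe; rewrite {1}(cubicE f_cubic).
rewrite !(comp_polyD, comp_polyZ, comp_polyC, comp_polyX, comp_Xn_poly).
rewrite (horner_deriv_cubic f_cubic); move: fe; rewrite (horner_cubic f_cubic).
move/eqP; rewrite -!addrA addr_eq0 => /eqP ->.
by rewrite -!mul_polyC ?(polyC_natr, polyCN, polyCD, polyCM, polyC_exp); ring.
Qed.

(* [e] is the last root in the direction [s / f_3], so that the cubic keeps a
   constant sign beyond it. *)
Lemma extremal_root (s : R) : s ^+ 2 = 1 -> exists e, [/\ f.[e] = 0,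
  0 < f`_3 * f^`().[e] & forall x, 0 < x ->
    0 < x ^+ 2 + s * (3 * f`_3 * e + f`_2) * x + f`_3 * f^`().[e]].
Proof.
move=> s2; have a0 := cubic_lead_neq0 f_cubic.
have [e0 /eqP fe0] : {x | root f x} by apply: odd_poly_root; rewrite f_cubic.
(* With argument [al * z + e0] the cubic becomes [s * al ^ 2 * z * (z ^ 2 + b * z + d)]: this choice
   of [al] makes the quadratic factor monic and lets [z] grow in the required direction. *)
pose al := s / f`_3; have aal : f`_3 * al = s by rewrite /al mulrC divfK.
have s0 : s != 0 by rewrite -sqrf_eq0 s2 oner_eq0.
have al0 : al != 0 by rewrite mulf_neq0 ?invr_eq0.
pose b := s * (3 * f`_3 * e0 + f`_2); pose d := f`_3 * f^`().[e0].
have d0 : d != 0.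
  by rewrite mulf_neq0 ?simple_root.
have [disc|disc] := ltP (b ^+ 2 - 4 * d) 0.
  exists e0; split=> // [|x x0]; rewrite -/d -?/b.
    by have := sqr_ge0 b; lra.
  by have := sqr_ge0 (2 * x + b); nra.
pose de := Num.sqrt (b ^+ 2 - 4 * d).
have de2 : de ^+ 2 = b ^+ 2 - 4 * d by rewrite sqr_sqrtr.
have de_ge0 : 0 <= de by apply: sqrtr_ge0.
(* The larger root of the quadratic factor; the last root of the cubic is at the larger of [0] and
   [r]. *)
pose r := (- b + de) / 2.
have rE : de = 2 * r + b by rewrite /r; field.
have [r_le0|r_gt0] := leP r 0.
  have d_gt0 : 0 < d by rewrite lt_neqAle eq_sym d0 /=; nra.
  by exists e0; split=> // x x0; rewrite -/d -/b; nra.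
exists (al * r + e0).
have horner_at x : f.[al * x + e0] = s * al ^+ 2 * (x * (x ^+ 2 + b * x + d)).
  have := congr1 (horner^~ x) (comp_at_root al fe0).
  rewrite horner_comp !(hornerD, hornerZ, hornerX, hornerC, hornerXn) => ->.
  rewrite /b /d -aal; move: s2; rewrite -aal => s2.
  transitivity (f`_3 * al ^+ 3 * x ^+ 3 + (f`_3 * al) ^+ 2 * (3 * f`_3 * e0 +
    f`_2) * al ^+ 2 * x ^+ 2 +
      (f`_3 * al) ^+ 2 * f^`().[e0] * al * x); last by ring.
  by rewrite s2; ring.
have rd : r ^+ 2 + b * r + d = 0 by rewrite rE in de2; nra.
have f0 : f.[al * r + e0] = 0 by rewrite horner_at rd !mulr0.
have bE : s * (3 * f`_3 * (al * r + e0) + f`_2) = r + de.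
  rewrite rE /b -aal; move: s2; rewrite -aal => s2.
  transitivity (3 * (f`_3 * al) ^+ 2 * r + f`_3 * al * (3 * f`_3 * e0 + f`_2)).
    by ring.
  by rewrite s2; ring.
have dE : f`_3 * f^`().[al * r + e0] = r * de.
  have := congr1 (fun p => p^`().[r]) (comp_at_root al fe0).
  rewrite deriv_comp hornerM horner_comp !derivE !(hornerD, hornerZ, hornerX,
    hornerC, hornerXn, hornerMn) /= => h.
  apply: (mulIf al0).
  transitivity (f`_3 * (f^`().[al * r + e0] * (al * 1 + 0))); first by ring.
  have -> : f^`().[al * r + e0] * (al * 1 + 0) = f`_3 * al ^+ 3 * (3 * r ^+ 2)
      + (3 * f`_3 * e0 + f`_2) * al ^+ 2 * (2 * r) + f^`().[e0] * al.
    by rewrite h !(hornerD, hornerM, hornerX) -?polyC1 !hornerC; ring.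
  have dE : d = - (r ^+ 2 + b * r) by rewrite -[RHS]addr0 -rd; ring.
  transitivity (al * (3 * (f`_3 * al) ^+ 2 * r ^+ 2 + 2 * b * r + d)).
    by rewrite /b /d -aal; ring.
  by rewrite aal s2 dE rE; ring.
have := mulf_neq0 a0 (simple_root f_sep f0); rewrite dE => rde0.
have de_gt0 : 0 < de.
  by rewrite lt_neqAle de_ge0 andbT eq_sym; apply: contraNneq rde0 => ->;
    rewrite mulr0.
split=> //; first by rewrite mulr_gt0.
by move=> x x0; rewrite bE; nra.
Qed.

(** [s = 1] gives a model of the curve and [s = -1] one of its twist: the factor [s * al ^ 2] will
    be the square of the scale of the ordinate, real or purely imaginary. *)
Lemma normal_form (s : R) : s ^+ 2 = 1 -> exists (E : normal_curve R) al ga,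
  al != 0 /\ (s * al ^+ 2) *: (E : {poly R}) = f \Po (al *: 'X + ga%:P).
Proof.
move=> s2; have a0 := cubic_lead_neq0 f_cubic.
have [e [fe d0 pos]] := extremal_root s2.
set b := s * _ in pos; set d := (f`_3 * _) in d0 pos.
pose al := s / f`_3; have aal : f`_3 * al = s by rewrite /al mulrC divfK.
have s0 : s != 0 by rewrite -sqrf_eq0 s2 oner_eq0.
have al0 : al != 0 by rewrite mulf_neq0 ?invr_eq0.
have c0 : s * al ^+ 2 != 0 by rewrite mulf_neq0 ?expf_neq0.
pose p : {poly R} := 'X^3 + b *: 'X^2 + d *: 'X.
have pE : (s * al ^+ 2) *: p = f \Po (al *: 'X + e%:P).
  rewrite comp_at_root // !scalerDr !scalerA.
  congr (_ *: _ + _ *: _ + _ *: _); rewrite /b /d -?aal.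
  - by ring.
  - by rewrite aal; transitivity (s ^+ 2 * (3 * f`_3 * e + f`_2) * al ^+ 2);
      [ring | rewrite s2; ring].
  - transitivity ((f`_3 * al) ^+ 2 * f^`().[e] * al);
      [ring | by rewrite aal s2; ring].
have p_cubic : size p = 4%N.
  rewrite /p -addrA size_polyDl size_polyXn //.
  apply: (leq_ltn_trans (size_polyD _ _)); rewrite gtn_max.
  by rewrite !(leq_ltn_trans (size_scale_leq _ _)) ?size_polyXn ?size_polyX.
have p_sep : separable_poly p.
  have -> : p = (s * al ^+ 2)^-1 *: (f \Po (al *: 'X + e%:P)).
    by rewrite -pE scalerA mulVf // scale1r.
  by apply: separable_affine; rewrite ?invr_eq0.
by exists (NormalCurve (nc_curve := ECurve p_cubic p_sep real_two_neq0) erefl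
  d0 pos), al, e.
Qed.
End NormalForm.

(** * Counting stable cyclic subgroups *)

Lemma card_uniq_seq (T : eqType) (s : seq T) :
  uniq s -> [set x | x \in s] #= `I_(size s).
Proof.
case: s => [|x0 s'] s_uniq.
  by rewrite (_ : [set x | _] = set0) ?II0 // -subset0 => x.
move: (x0 :: s') s_uniq => s s_uniq.
have -> : [set x | x \in s] = nth x0 s @` `I_(size s).
  apply/seteqP; split=> [x xs|_ [i /= lt_i <-]]; last exact: mem_nth.
  by exists (index x s); [rewrite /= index_mem | rewrite nth_index].
by apply: inj_card_eq => i j; rewrite !inE /= => li lj /eqP;
  rewrite nth_uniq // => /eqP.
Qed.

Lemma card_image2 (T U V : pointedType) (A : set T) (B : set U)
    (h : T -> U -> V) a b :
  {in A &, forall x y, {in B &, forall z t, h x z = h y t -> x = y /\ z = t}} ->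
  A #= `I_a -> B #= `I_b ->
  [set z | exists x y, [/\ A x, B y & z = h x y]] #= `I_(a * b).
Proof.
move=> h_inj; rewrite card_eq_sym => /card_set_bijP[e1 [e1A e1inj e1surj]].
rewrite card_eq_sym => /card_set_bijP[e2 [e2B e2inj e2surj]].
pose e i := h (e1 (i %/ b)%N) (e2 (i %% b)%N).
have b_gt0 i : `I_(a * b) i -> (0 < b)%N by rewrite /=;
  case: b {e e2B e2inj e2surj} => //; rewrite muln0.
have lt1 i : `I_(a * b) i -> `I_a (i %/ b)%N.
  by move=> li; rewrite /= ltn_divLR ?(b_gt0 i li) //; exact: li.
have lt2 i : `I_(a * b) i -> `I_b (i %% b)%N.
  by move=> li; rewrite /= ltn_mod (b_gt0 i li).
have -> : [set z | exists x y, [/\ A x, B y & z = h x y]] = e @` `I_(a * b).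
  apply/seteqP; split=> [_ [x [y [Ax By ->]]]|_ [i li <-]]; last first.
    by exists (e1 (i %/ b)%N), (e2 (i %% b)%N); split=> //;
      [apply/e1A/lt1 | apply/e2B/lt2].
  have [i /= li <-] := e1surj x Ax; have [j /= lj <-] := e2surj y By.
  have b0 : (0 < b)%N by exact: leq_ltn_trans lj.
  exists (i * b + j)%N; rewrite /=.
    by rewrite (leq_trans (_ : _ < i.+1 * b)%N) ?leq_mul2r ?li ?orbT // mulSn
      addnC ltn_add2r.
  by rewrite /e divnMDl // divn_small // addn0 modnMDl modn_small.
apply: inj_card_eq => i j; rewrite !inE => li lj.
case/h_inj; rewrite ?inE;
  [exact/e1A/lt1|exact/e1A/lt1|exact/e2B/lt2|exact/e2B/lt2|].
move=> e1E e2E; rewrite (divn_eq i b) (divn_eq j b).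
congr (_ * _ + _)%N; [apply: e1inj e1E | apply: e2inj e2E]; rewrite inE;
  by [exact: lt1 | exact: lt2].
Qed.

Section StableCyclic.
Variables (G : zmodType) (sigma : {additive G -> G}).
Hypothesis sigmaK : involutive sigma.

(* [has_order P 0] says that [P] has infinite order. *)
Definition has_order (P : G) N := forall j, (P *+ j == 0) = (N %| j)%N.

(* Only natural multiples: this is the generated subgroup when [P] has finite
   order. *)
Definition cyc (P : G) : set G := [set Q | exists k, Q = P *+ k].

Definition stable_cyclic N : set (set G) :=
  [set S | exists P, [/\ has_order P N, cyc P (sigma P) & S = cyc P]].

Lemma cyc_id P : cyc P P. Proof. by exists 1%N; rewrite mulr1n. Qed.

Lemma cycM P u : cyc (P *+ u) `<=` cyc P.
Proof. by move=> _ [k ->]; exists (u * k)%N; rewrite mulrnA. Qed.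

Lemma cyc_sub P Q : cyc P Q -> cyc Q `<=` cyc P.
Proof. by move=> [k ->]; apply: cycM. Qed.

Lemma mulrn_modn P N j : has_order P N -> P *+ (j %% N) = P *+ j.
Proof.
move=> oP; rewrite {2}(divn_eq j N) mulrnDr; have /eqP -> : P *+ (j %/ N * N) == 0.
  by rewrite oP dvdn_mull.
by rewrite add0r.
Qed.

Lemma mulrn_eqmod P N i j :
  has_order P N -> (P *+ i == P *+ j) = (i == j %[mod N]).
Proof.
move=> oP; wlog ij : i j / (j <= i)%N => [wl|].
  by case/orP: (leq_total i j) => /wl // h; rewrite eq_sym h eq_sym.
by rewrite -subr_eq0 -mulrnBr // oP eqn_mod_dvd.
Qed.

Lemma cyc_coprime P N u : has_order P N -> coprime u N -> cyc (P *+ u) = cyc P.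
Proof.
move=> oP co; apply/seteqP; split; first exact: cycM.
case: N oP co => [|N] oP co.
  by move: co; rewrite /coprime gcdn0 => /eqP ->; rewrite mulr1n.
apply: cyc_sub; exists (u ^ (totient N.+1).-1)%N; apply/esym/eqP.
rewrite -mulrnA -expnS prednK ?totient_gt0 //.
by rewrite -[X in _ == X]mulr1n (mulrn_eqmod _ _ oP) Euler_exp_totient.
Qed.

Lemma has_order_mul P n m : (0 < m)%N -> has_order P (n * m)%N ->
  has_order (P *+ m) n.
Proof. by move=> m0 oP j; rewrite -mulrnA oP mulnC dvdn_pmul2l. Qed.

Lemma cyc_stable P : cyc P (sigma P) -> forall Q, cyc P Q -> cyc P (sigma Q).
Proof.
by move=> [u su] _ [k ->]; exists (u * k)%N; rewrite raddfMn su mulrnA.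
Qed.

Section Coprime.
Variables (n m : nat).
Hypotheses (n0 : (0 < n)%N) (m0 : (0 < m)%N) (co : coprime n m).

Lemma cyc_sum P1 P2 k l : has_order P1 n -> has_order P2 m ->
  cyc (P1 + P2) (P1 *+ k + P2 *+ l).
Proof.
move=> o1 o2; exists (chinese n m k l); rewrite mulrnDl; congr (_ + _);
  apply/esym/eqP.
  by rewrite (mulrn_eqmod _ _ o1) chinese_modl.
by rewrite (mulrn_eqmod _ _ o2) chinese_modr.
Qed.

Lemma has_order_sum P1 P2 : has_order P1 n -> has_order P2 m ->
  has_order (P1 + P2) (n * m)%N.
Proof.
move=> o1 o2 j; rewrite Gauss_dvd // -o1 -o2 mulrnDl.
apply/eqP/andP => [e|[/eqP -> /eqP ->]]; last by rewrite addr0.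
have : P1 *+ (j * m) == 0.
  have := congr1 (fun Q => Q *+ m) e; rewrite /= mulrnDl mul0rn -!mulrnA.
  have /eqP -> : P2 *+ (j * m) == 0 by rewrite o2 dvdn_mull.
  by rewrite addr0 => ->.
rewrite o1 Gauss_dvdl // -o1 => e1; split=> //.
by move: e; rewrite (eqP e1) add0r => ->.
Qed.

(** The bijection sends a pair of subgroups to their sum; the summands are recovered as its
    [n]-torsion and its [m]-torsion. *)
Lemma card_stable_mul a b : stable_cyclic n #= `I_a -> stable_cyclic m #= `I_b ->
  stable_cyclic (n * m) #= `I_(a * b).
Proof.
pose h (S T : set G) := [set Q | exists Q1 Q2, [/\ S Q1, T Q2 & Q = Q1 + Q2]].
have hE P1 P2 : has_order P1 n -> has_order P2 m -> h (cyc P1) (cyc P2) = cyc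
  (P1 + P2).
  move=> o1 o2; apply/seteqP; split=> [_ [_ [_ [[k ->] [l ->] ->]]]|_ [k ->]].
    exact: cyc_sum.
  by exists (P1 *+ k), (P2 *+ k); split; rewrite ?mulrnDl //; [exists k | exists k].
have -> : stable_cyclic (n * m) =
    [set S | exists T U, [/\ stable_cyclic n T, stable_cyclic m U & S = h T U]].
  apply/seteqP; split=> [_ [P [oP sP ->]]|_ [_ [_ [[P1 [o1 s1 ->]] [P2 [o2 s2
    ->]] ->]]]].
    have o1 : has_order (P *+ m) n by apply: has_order_mul.
    have o2 : has_order (P *+ n) m by apply: has_order_mul; rewrite // mulnC.
    exists (cyc (P *+ m)), (cyc (P *+ n)); split.
    - exists (P *+ m); split=> //; case: sP => u su; exists u.
      by rewrite raddfMn su mulrnAC.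
    - exists (P *+ n); split=> //; case: sP => u su; exists u.
      by rewrite raddfMn su mulrnAC.
    (* The two components add up to [P *+ (m + n)], still a generator because [m + n] is prime to
       [n * m]. *)
    - rewrite hE // -mulrnDr (cyc_coprime oP) // coprimeMr.
      rewrite ![coprime (m + n) _]coprime_sym /coprime gcdnDr gcdnDl.
      by rewrite [gcdn m n]gcdnC andbb; exact: co.
  exists (P1 + P2); rewrite hE //; split=> //; first exact: has_order_sum.
  by case: s1 => u su; case: s2 => v sv; rewrite raddfD su sv; apply: cyc_sum.
apply: card_image2 => S T; rewrite !inE => -[P1 [o1 _ ->]] [P2 [o2 _ ->]] U V.
rewrite !inE => -[Q1 [q1 _ ->]] [Q2 [q2 _ ->]].
have part1 P Q : has_order P n -> has_order Q m ->
    cyc P = [set S | h (cyc P) (cyc Q) S /\ S *+ n = 0].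
  move=> oP oQ; apply/seteqP; split=> [_ [k ->]|_ [[_ [_ [[k ->] [l ->] ->]]]]].
    split; last by apply/eqP; rewrite -mulrnA oP dvdn_mull.
    by exists (P *+ k), 0; split; [exists k | exists 0%N | rewrite addr0].
  rewrite mulrnDl -!mulrnA; have /eqP -> : P *+ (k * n) == 0 by rewrite oP
    dvdn_mull.
  rewrite add0r => /eqP; rewrite oQ Gauss_dvdl 1?coprime_sym // -oQ => /eqP ->.
  by rewrite addr0; exists k.
have part2 P Q : has_order P n -> has_order Q m ->
    cyc Q = [set S | h (cyc P) (cyc Q) S /\ S *+ m = 0].
  move=> oP oQ; apply/seteqP; split=> [_ [k ->]|_ [[_ [_ [[k ->] [l ->] ->]]]]].
    split; last by apply/eqP; rewrite -mulrnA oQ dvdn_mull.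
    by exists 0, (Q *+ k); split; [exists 0%N | exists k | rewrite add0r].
  rewrite mulrnDl -!mulrnA; have /eqP -> : Q *+ (l * m) == 0 by rewrite oQ
    dvdn_mull.
  rewrite addr0 => /eqP; rewrite oP Gauss_dvdl // -oP => /eqP ->.
  by rewrite add0r; exists l.
move=> e; split; first by rewrite (part1 P1 Q1) // e -part1.
by rewrite (part2 P1 Q1) // e -part2.
Qed.
End Coprime.

Definition sign_of (s : bool) (P : G) := if s then - P else P.

(** For either sign, the [n]-torsion points on which [sigma] acts by that sign form a cyclic group
    of order [n]. *)
Definition eigen_cyclic n := forall s, exists B, [/\ has_order B n,
  sigma B = sign_of s B & forall P, P *+ n = 0 -> sigma P = sign_of s P -> cyc B P].

Lemma card_stable_prime_power p k : prime p -> odd p -> (0 < k)%N ->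
  eigen_cyclic (p ^ k) -> stable_cyclic (p ^ k) #= `I_2.
Proof.
move=> p_pr p_odd k0 eig.
have pk_gt1 : (1 < p ^ k)%N by rewrite -(expn0 p) ltn_exp2l ?prime_gt1.
have [B0 [o0 s0 g0]] := eig false; have [B1 [o1 s1 g1]] := eig true.
pose B s := if s then B1 else B0.
have oB s : has_order (B s) (p ^ k) by case: s.
have sB s : sigma (B s) = sign_of s (B s) by case: s.
have gB s P : P *+ (p ^ k) = 0 -> sigma P = sign_of s P -> cyc (B s) P.
  by case: s; [apply: g1 | apply: g0].
have -> : stable_cyclic (p ^ k) = (cyc \o B) @` [set s | s \in [:: true; false]].
  apply/seteqP; split=> [_ [P [oP [u su] ->]]|_ [s _ <-]]; last first.
    exists (B s); split=> //; rewrite sB; case: s => /=; last exact: cyc_id.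
    exists (p ^ k).-1; apply/eqP; rewrite eq_sym -addr_eq0 -mulrSr.
    by rewrite prednK ?o1 // ltnW.
  have Pk : P *+ (p ^ k) = 0 by apply/eqP; rewrite oP.
  have [s sP] : exists s, sigma P = sign_of s P.
    have uu : P *+ (u * u) == P *+ 1 by rewrite mulrnA -su -raddfMn -su sigmaK
      mulr1n.
    have u_gt0 : (0 < u)%N.
      rewrite lt0n; apply/eqP => u0; move: uu; rewrite u0 mul0n.
      by rewrite (mulrn_eqmod _ _ oP) eq_sym eqn_mod_dvd // subn0 dvdn1 gtn_eqF.
    move: uu; rewrite (mulrn_eqmod _ _ oP) eqn_mod_dvd ?muln_gt0 ?u_gt0 //.
    rewrite (_ : (u * u - 1 = (u - 1) * (u + 1))%N);
      last by rewrite -{2}[1%N]mul1n -subn_sqr.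
    have [pu|pu] := boolP (p %| u - 1)%N.
      have pu1 : coprime (p ^ k) (u + 1).
        rewrite coprimeXl // prime_coprime //; apply/negP => pu1.
        have : (p %| 2)%N.
          by have := dvdn_sub pu1 pu; rewrite (_ : (u + 1 - (u - 1) = 2)%N) //; lia.
        by move/(dvdn_leq (isT : 0 < 2)%N); have := prime_gt1 p_pr;
          case: (p) p_odd => [|[|[|]]].
      rewrite Gauss_dvdl // -eqn_mod_dvd // -(mulrn_eqmod _ _ oP) => /eqP e.
      by exists false; rewrite su e mulr1n.
    have pu1 : coprime (p ^ k) (u - 1) by rewrite coprimeXl // prime_coprime.
    rewrite Gauss_dvdr // -oP mulrnDr mulr1n addr_eq0 => /eqP e.
    by exists true; rewrite su e.
  exists s; first by case: (s).
  (* [j] is prime to [p], since otherwise [p ^ k.-1] would already kill [P]; so [P] generates the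
     whole group of [B s]. *)
  have [j Pj] := gB s P Pk sP; rewrite /= Pj (cyc_coprime (oB s)) //.
  rewrite coprime_sym coprimeXl // prime_coprime //; apply/negP => /dvdnP[q jq].
  have : P *+ (p ^ k.-1) == 0.
    rewrite Pj -mulrnA oB jq -mulnA -expnS prednK //; exact: dvdn_mull.
  rewrite oP => /dvdn_leq; rewrite expn_gt0 prime_gt0 // => /(_ isT).
  by rewrite leq_exp2l ?prime_gt1 // leqNgt prednK // leqnn.
apply: card_eq_trans (card_uniq_seq (isT : uniq [:: true; false])).
(* If the groups agreed, [sigma] would both fix and negate [B1], which would be killed by 2 in spite
   of its odd order. *)
have ne : cyc B1 <> cyc B0.
  move=> e; have [j ej] : cyc B0 B1 by rewrite -e; exact: cyc_id.
  have : B1 *+ 2 == 0.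
    rewrite mulr2n addr_eq0; have := s1; rewrite {1}ej raddfMn s0 -ej /= => h.
    by rewrite {1}h.
  rewrite o1 => /(dvdn_leq (isT : 0 < 2)%N) le2.
  have : odd (p ^ k) by rewrite oddX p_odd orbT.
  by move: pk_gt1 le2; case: (p ^ k)%N => [|[|[|]]].
by apply: inj_card_eq => -[] [] //= _ _ e; case: ne.
Qed.

Lemma card_stable_odd N : odd N ->
  (forall n, odd n -> eigen_cyclic n) ->
  stable_cyclic N #= `I_(2 ^ size (primes N)).
Proof.
move=> + eig; elim/ltn_ind: N => N IH N_odd.
have N0 := odd_gt0 N_odd.
have [N1|N1] := eqVneq N 1%N.
  rewrite N1 /= expn0.
  have -> : stable_cyclic 1 = [set cyc 0].
    apply/seteqP; split=> [_ [P [oP _ ->]]|_ ->].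
      by have := oP 1%N; rewrite mulr1n dvdnn => /eqP ->.
    exists 0; split=> //; last by rewrite raddf0; exact: cyc_id.
    by move=> j; rewrite mul0rn eqxx dvd1n.
  exact: card_set1.
have N_gt1 : (1 < N)%N by rewrite ltn_neqAle eq_sym N1.
pose p := pdiv N; have p_pr : prime p := pdiv_prime N_gt1.
have pN : (p %| N)%N := pdiv_dvd N.
have p_odd : odd p := dvdn_odd pN N_odd.
have k0 : (0 < logn p N)%N by rewrite logn_gt0 mem_primes p_pr N0.
have [M coM NE] := pfactor_coprime p_pr N0.
have M_odd : odd M by move: N_odd; rewrite NE oddM => /andP[].
have M0 := odd_gt0 M_odd.
have M_lt : (M < N)%N.
  by rewrite [X in (_ < X)%N]NE -[X in (X < _)%N]muln1 ltn_pmul2l // -(expn0 p)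
    ltn_exp2l ?prime_gt1.
have szE : size (primes N) = (size (primes M)).+1.
  suff /perm_size -> : perm_eq (primes N) (p :: primes M) by [].
  apply: uniq_perm; rewrite ?primes_uniq //=.
    by rewrite primes_uniq andbT mem_primes p_pr M0 /= -prime_coprime.
  move=> q; rewrite {1}NE primesM ?M0 ?expn_gt0 ?(prime_gt0 p_pr) // inE orbC.
  by rewrite primesX // primes_prime // inE.
rewrite {1}NE szE expnSr; apply: card_stable_mul => //.
- by rewrite coprime_sym coprimeXl.
- exact: IH.
- by apply: card_stable_prime_power => //; apply: eig; rewrite oddX p_odd orbT.
Qed.
End StableCyclic.

(** * Real points and the quadratic twist *)

Section ComplexCurve.
Variables (R : realType) (f : {poly R}).
Hypotheses (f_cubic : size f = 4%N) (f_sep : separable_poly f).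

Fact complexify_cubic : size (complexify f) = 4%N.
Proof. by rewrite size_map_poly. Qed.
Fact complexify_sep : separable_poly (complexify f).
Proof. by rewrite separable_map. Qed.
Fact complex_two_neq0 : 2 != 0 :> R[i].
Proof. by rewrite pnatr_eq0. Qed.

Definition complex_curve : ecurve R[i] :=
  ECurve complexify_cubic complexify_sep complex_two_neq0.
Local Notation E := complex_curve.

Lemma complexify_horner x : (E : {poly R[i]}).[x%:C%C] = (f.[x])%:C%C.
Proof. exact: horner_map. Qed.

Lemma conjc_fixed (x : R[i]) : conjc x = x -> exists r, x = r%:C%C.
Proof. by case: x => a b /= [] ?; exists a; congr Complex; lra. Qed.

Lemma conj_additive : exists sigma : {additive ecp E -> ecp E},
  forall P, \val (sigma P) = conj_point (\val P).
Proof.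
have E12 : 1 ^+ 2 *: map_poly conjc E = E \Po (1 *: 'X + 0%:P).
  rewrite expr1n !scale1r addr0 comp_polyXr -map_poly_comp.
  by apply: eq_map_poly => x; exact: conjc_real.
have [phi [_ phiE]] := transport (oner_neq0 _) (oner_neq0 _) E12.
exists phi => P; rewrite phiE; case: (\val P) => //= x y.
by rewrite !mul1r addr0.
Qed.

(** [phi] identifies the real points of the normal model with the complex points on which
    conjugation acts by the sign [s], so the cyclic odd torsion of the model carries over. *)
Lemma signed_torsion (sigma : {additive ecp E -> ecp E}) n :
  (forall P, \val (sigma P) = conj_point (\val P)) -> odd n ->
  eigen_cyclic sigma n.
Proof.
move=> sigmaE n_odd s.
have [N [al [ga [al0 NE]]]] := normal_form f_cubic f_sep (sqrr_sign R s).
(* For [s = true] the factor [i] makes the normal curve a model of the quadratic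
   twist, on whose points conjugation acts as negation. *)
pose be : R[i] := al%:C%C * (if s then 'i%C else 1).
have alC0 : al%:C%C != 0 :> R[i] by rewrite fmorph_eq0.
have i0 : 'i%C != 0 :> R[i] by rewrite -sqrf_eq0 sqr_i oppr_eq0 oner_eq0.
have be0 : be != 0 by rewrite mulf_neq0 //; case: (s); rewrite ?oner_neq0.
have be2 : be ^+ 2 = ((-1) ^+ s * al ^+ 2)%:C%C.
  rewrite exprMn mulrC rmorphM !rmorphXn rmorphN1; congr (_ * _).
  by case: (s); rewrite ?sqr_i ?expr1n.
have conj_be : conjc be = if s then - be else be.
  have ci : conjc 'i%C = - 'i%C :> R[i].
    by apply/eqP; rewrite eq_complex /= oppr0 !eqxx.
  have -> : conjc be = al%:C%C * conjc (if s then 'i%C else 1).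
    by rewrite /be [LHS]rmorphM; congr (_ * _); exact: conjc_real.
  by rewrite /be; case: (s); rewrite ?ci ?mulrN //; congr (_ * _); exact: conjc1.
have E12 : be ^+ 2 *: map_poly (real_complex R) N = E \Po (al%:C%C *: 'X +
  (ga%:C%C)%:P).
  rewrite be2 -map_polyZ NE map_comp_poly /= rmorphD /= map_polyZ map_polyX
    map_polyC.
  by [].
have [phi [phi_inj phiE]] := transport alC0 be0 E12.
have [B0 [ordB genB]] := normal_odd_torsion N n_odd.
have sigma_phi P : sigma (phi P) = sign_of s (phi P).
  apply: val_inj; rewrite sigmaE phiE.
  have -> : \val (sign_of s (phi P)) = (if s then @ec_opp R[i] else id) (\val
    (phi P)).
    by rewrite /sign_of; case: (s).
  rewrite phiE; case: (\val P) => [|x y] /=; first by case: (s).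
  have conj_real (u v w : R) :
      conjc (u%:C%C * v%:C%C + w%:C%C) = u%:C%C * v%:C%C + w%:C%C.
    by rewrite -rmorphM -rmorphD; exact: conjc_real.
  have conj_y : conjc (be * y%:C%C) = (if s then - (be * y%:C%C) else be * y%:C%C).
    have -> : conjc (be * y%:C%C) = conjc be * y%:C%C.
      by rewrite [LHS]rmorphM; congr (_ * _); exact: conjc_real.
    by rewrite conj_be; case: (s); rewrite //= mulNr.
  transitivity (Affine (al%:C%C * x%:C%C + ga%:C%C) (conjc (be * y%:C%C))).
    by congr Affine; exact: conj_real.
  by rewrite conj_y; case: (s).
exists (phi B0); split=> [j| |P Pn sP] //.
  by rewrite -raddfMn raddf_eq0.
suff [Q PQ] : exists Q, P = phi Q.
  have [|m e] := genB Q; last by exists m; rewrite PQ e raddfMn.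
  by apply: phi_inj; rewrite raddfMn raddf0 -PQ.
case: (ecp_case P) sP => [|x y e] sP; first by exists 0; rewrite raddf0.
have : conj_point (Affine x y) = (if s then @ec_opp R[i] else id) (Affine x y).
  by rewrite -[conj_point _]/(conj_point (\val (mk_ecp e))) -sigmaE sP
    /sign_of; case: (s).
have -> : (if s then @ec_opp R[i] else id) (Affine x y) = Affine x (if s then -
  y else y).
  by case: (s).
case=> /conjc_fixed[u xu] cy.
(* Conjugation multiplies [y] and [be] by the same sign, so the quotient is real. *)
have [v yv] : exists v, y / be = v%:C%C.
  apply: conjc_fixed; rewrite [LHS]rmorphM fmorphV /= cy conj_be.
  by case: (s); rewrite // invrN mulrNN.
have xE : al%:C%C * ((u - ga) / al)%:C%C + ga%:C%C = x.
  have e0 : al * ((u - ga) / al) + ga = u by field.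
  transitivity (real_complex R (al * ((u - ga) / al) + ga)); last by rewrite e0 xu.
  by rewrite [RHS]rmorphD; congr (_ + _); rewrite [RHS]rmorphM.
have yE : be * v%:C%C = y by rewrite -yv mulrC divfK.
have eN : v ^+ 2 = N.[(u - ga) / al].
  apply: complexI; rewrite rmorphXn; apply: (mulfI (expf_neq0 2 be0)).
  by rewrite (transport_horner E12) xE -e -yE [RHS]exprMn.
by exists (mk_ecp eN); apply: val_inj; rewrite phiE /= xE yE.
Qed.
End ComplexCurve.

Lemma has_orderP (G : zmodType) (P : G) n : (0 < n)%N -> P *+ n = 0 ->
  (forall i, (0 < i < n)%N -> P *+ i != 0) -> has_order P n.
Proof.
move=> n0 Pn Pi j; rewrite {1}(divn_eq j n) mulrnDr mulnC mulrnA Pn mul0rn add0r.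
rewrite /dvdn; have [->|jn] := eqVneq (j %% n)%N 0%N; first by rewrite mulr0n eqxx.
by apply/negbTE/Pi; rewrite lt0n jn ltn_mod.
Qed.

(** * Orders two and four *)

(* Abscissas of the stable cyclic subgroups of order 4. *)
Lemma quarter_points (R : realType) (f : {poly R}) :
  size f = 4%N -> separable_poly f ->
  exists s : seq R, [/\ uniq s, size s = 2%N \/ size s = 4%N &
    forall x, x \in s <-> exists e, f.[e] = 0 /\ f`_3 * (x - e) ^+ 2 = f^`().[e]].
Proof.
move=> f_cubic f_sep; have a0 := cubic_lead_neq0 f_cubic.
set a := f`_3 in a0 *.
have taylor e z : f.[z] = f.[e] + (z - e) * (a * (z - e) ^+ 2
    + (3 * a * e + f`_2) * (z - e) + f^`().[e]).
  by rewrite !(horner_cubic f_cubic) (horner_deriv_cubic f_cubic) -/a; ring.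
have dist e : 0 < a * f^`().[e] ->
    exists2 q, 0 < q & a * q ^+ 2 = f^`().[e].
  move=> d0; exists (Num.sqrt (f^`().[e] / a)).
    by rewrite sqrtr_gt0 -(pmulr_rgt0 _ (_ : 0 < a ^+ 2)) ?exprn_even_gt0 //
      mulrC expr2 mulrA divfK // mulrC.
  rewrite sqr_sqrtr; first by rewrite mulrC divfK.
  by rewrite -(pmulr_rge0 _ (_ : 0 < a ^+ 2)) ?exprn_even_gt0 //
      mulrC expr2 mulrA divfK // mulrC ltW.
have distE e q x : a * q ^+ 2 = f^`().[e] ->
    a * (x - e) ^+ 2 = f^`().[e] <-> x = e - q \/ x = e + q.
  move=> aq; split=> [|[] ->]; rewrite -aq; last 2 first.
  - by ring.
  - by ring.
  move/(mulfI a0)/eqP; rewrite eqf_sqr => /orP[] /eqP xe.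
    by right; rewrite -xe; ring.
  by left; rewrite -[q]opprK -xe; ring.
(* The extremal roots in the two directions; they coincide exactly when there is a single real
   root. *)
have [e1 [f1 d1 pos1]] := extremal_root f_cubic f_sep (expr1n _ 2).
have [e2 [f2 d2 pos2]] := extremal_root f_cubic f_sep (sqrr_sign R 1).
rewrite ?expr1 -/a in d1 pos1 d2 pos2.
have [e12|ne] := eqVneq e1 e2.
  subst e2; have [q q0 aq] := dist _ d1.
  exists [:: e1 - q; e1 + q]; split; [|by left|].
    by rewrite /= inE andbT; apply/eqP; lra.
  move=> x; rewrite !inE.
  split=> [h|[e [fe /eqP]]].
    exists e1; split=> //; apply/(distE _ q) => //.
    by case/orP: h => /eqP ->; [left | right].
  suff -> : e = e1.
    by move/eqP/(distE _ _ _ aq) => -[] ->; rewrite eqxx ?orbT.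
  apply/eqP; rewrite -subr_eq0; apply: contraT => en.
  have := taylor e1 e; rewrite fe f1 add0r => /esym/eqP.
  rewrite mulf_eq0 (negPf en) /= => /eqP q0'.
  (* [a * (e - e1)] would be a root of the monic quadratic in [pos1]; positive values are excluded
     by [pos1], negative ones by [pos2]. *)
  have X0 : a * (e - e1) != 0 by rewrite mulf_neq0.
  have X1 := pos1 (a * (e - e1)); have X2 := pos2 (- (a * (e - e1))).
  have eqX : a * (a * (e - e1) ^+ 2 + (3 * a * e1 + f`_2) * (e - e1) +
    f^`().[e1]) = 0.
    by rewrite q0' mulr0.
  by move: X0; rewrite neq_lt => /orP[] h; [have := X2 _ | have := X1 h]; nra.
(* Which of the two is smaller depends on the sign of the leading coefficient. The third root [e3]
   is found from the sum of the roots and turns out to lie between them. *)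
wlog lt12 : e1 e2 f1 f2 d1 d2 ne {pos1 pos2} / e1 < e2 => [wl|].
  have [lt|lt|e12] := ltgtP e1 e2; last by rewrite e12 eqxx in ne.
    exact: (wl e1 e2).
  by apply: (wl e2 e1); rewrite // eq_sym.
pose e3 := - f`_2 / a - e1 - e2.
have c2 : f`_2 = - a * (e1 + e2 + e3) by rewrite /e3; field.
have e21 : e2 - e1 != 0 by rewrite subr_eq0 eq_sym.
have c1 : f`_1 = a * (e1 * e2 + e1 * e3 + e2 * e3).
  apply: (mulIf e21).
  transitivity (f.[e2] - f.[e1] - (f`_2 * (e2 ^+ 2 - e1 ^+ 2) + a * (e2 ^+ 3 -
    e1 ^+ 3))).
    by rewrite !(horner_cubic f_cubic) -/a; ring.
  by rewrite f1 f2 c2; ring.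
have c0 : f`_0 = - a * (e1 * e2 * e3).
  transitivity (f.[e1] - (f`_1 * e1 + f`_2 * e1 ^+ 2 + a * e1 ^+ 3)).
    by rewrite (horner_cubic f_cubic) -/a; ring.
  by rewrite f1 c1 c2; ring.
have fE z : f.[z] = a * ((z - e1) * (z - e2) * (z - e3)).
  by rewrite (horner_cubic f_cubic) -/a c0 c1 c2; ring.
have dfE z : f^`().[z] =
    a * ((z - e1) * (z - e2) + (z - e1) * (z - e3) + (z - e2) * (z - e3)).
  by rewrite (horner_deriv_cubic f_cubic) -/a c1 c2; ring.
have [q1 q10 aq1] := dist _ d1; have [q2 q20 aq2] := dist _ d2.
have q1E : q1 ^+ 2 = (e2 - e1) * (e3 - e1).
  by apply: (mulfI a0); rewrite aq1 dfE; ring.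
have q2E : q2 ^+ 2 = (e2 - e1) * (e2 - e3).
  by apply: (mulfI a0); rewrite aq2 dfE; ring.
have q1sq : 0 < q1 ^+ 2 by rewrite exprn_gt0.
have q2sq : 0 < q2 ^+ 2 by rewrite exprn_gt0.
have e13 : e1 < e3 by nra.
have e32 : e3 < e2 by nra.
(* [q1] and [q2] are geometric means of the distances from [e1], respectively [e2], to the other two
   roots, so they lie strictly between these distances. This orders the four abscissas. *)
have l1 : e1 < e2 - q2 by nra.
have l2 : e2 - q2 < e3 by nra.
have l3 : e3 < e1 + q1 by nra.
have l4 : e1 + q1 < e2 by nra.
exists [:: e1 - q1; e2 - q2; e1 + q1; e2 + q2]; split; [|by right|].
  by rewrite /= !inE !negb_or -!andbA andbT; apply/and5P; split;
    try (apply/andP; split); apply/eqP; lra.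
move=> x; rewrite !inE; split=> [|[e [fe]]].
  case/or4P => /eqP ->; [exists e1|exists e2|exists e1|exists e2];
    split=> //; [apply/(distE _ q1)|apply/(distE _ q2)|apply/(distE _
      q1)|apply/(distE _ q2)] => //;
    by [left | right].
move: fe; rewrite fE => /eqP;
  rewrite mulf_eq0 (negPf a0) /= !mulf_eq0 -orbA !subr_eq0.
case/or3P => /eqP ->.
- by move/(distE _ _ _ aq1) => -[] ->; rewrite eqxx ?orbT.
- by move/(distE _ _ _ aq2) => -[] ->; rewrite eqxx ?orbT.
(* At the middle root, [(x - e3) ^ 2] would equal the negative number [(e3 - e1) * (e3 - e2)]. *)
rewrite dfE => /(mulfI a0) h.
have := sqr_ge0 (x - e3); rewrite h; nra.
Qed.

Section TwoPower.
Variables (K : fieldType) (E : ecurve K).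

Lemma mk_ecp_dbl0 x y (e : y ^+ 2 = E.[x]) :
  (mk_ecp e + mk_ecp e == 0) = (y == 0).
Proof.
rewrite addr_eq0 mk_ecp_opp eqxx /= -addr_eq0 -mulr2n -mulr_natl mulf_eq0.
by rewrite (negPf (ec_char E)).
Qed.

(** The tangent at [P] gives [f - (l X + m)^2] as the leading coefficient times
    [(X - x)^2 (X - x3)]. This identity and its derivative are evaluated at [e]; the double is
    [(e, 0)] when [x3 = e] and [l e + m = 0]. *)
Lemma dbl_eq_two_torsion x y (P : y ^+ 2 = E.[x]) e (Q : 0 ^+ 2 = E.[e]) :
  y != 0 ->
  (mk_ecp P + mk_ecp P = mk_ecp Q <-> E`_3 * (x - e) ^+ 2 = E^`().[e]).
Proof.
move=> y0; have a0 := cubic_lead_neq0 (ec_cubic E).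
have nP : mk_ecp P != - mk_ecp P by rewrite -addr_eq0 mk_ecp_dbl0.
have [l [m [x3 [S [-> yE _ ol _]]]]] := ecpD_on_line nP.
have line := on_line_poly (ec_cubic E) ol.
have dfE : E^`().[e] = 2 * l * (l * e + m) + E`_3 * ((e - x) ^+ 2 + 2 * (e - x)
  * (e - x3)).
  have := congr1 (fun p => p^`().[e]) line.
  rewrite derivB hornerD hornerN => /eqP; rewrite subr_eq => /eqP ->.
  rewrite !derivE !(hornerD, hornerM, hornerN, hornerC, hornerX) -?polyC1
    ?hornerC; ring.
have fE : - (l * e + m) ^+ 2 = E`_3 * (e - x) ^+ 2 * (e - x3).
  have := congr1 (horner^~ e) line; rewrite hornerD hornerN -Q expr0n /= add0r.
  rewrite !(hornerD, hornerM, hornerN, hornerC, hornerX, horner_exp) => ->; ring.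
have nx : e - x != 0.
  rewrite subr_eq0; apply: contraNneq y0 => ex.
  by rewrite -sqrf_eq0 P -ex -Q expr0n.
split=> [/mk_ecp_inj[ex ye]|h].
  by move/eqP: ye; rewrite oppr_eq0 ex => /eqP v0; rewrite dfE ex v0; ring.
have v0 : l * e + m = 0.
  (* Obtained by eliminating [e - x3] between the two evaluations, using [y = l x + m]. *)
  have h2 : (l * e + m) * (y * 2) = 0.
    have lv : 2 * l * (l * e + m) = - (2 * E`_3 * (e - x) * (e - x3)).
      transitivity (E^`().[e] - E`_3 * ((e - x) ^+ 2 + 2 * (e - x) * (e - x3))).
        by rewrite dfE; ring.
      by rewrite -h; ring.
    transitivity (- 2 * (- (l * e + m) ^+ 2) - (e - x) * (2 * l * (l * e + m))).
      by rewrite yE; ring.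
    by rewrite lv fE; ring.
  by move/eqP: h2; rewrite mulf_eq0 (mulf_eq0 y) (negPf y0) (negPf (ec_char E))
    !orbF => /eqP.
have ex : e = x3.
  move/eqP: fE; rewrite v0 expr0n oppr0 eq_sym !mulf_eq0 (negPf a0) /= orbb.
  by rewrite (negPf nx) subr_eq0 => /eqP.
by apply: val_inj; rewrite /= -ex v0 oppr0.
Qed.

Lemma has_order2 (P : ecp E) : has_order P 2 <->
  exists x (e : 0 ^+ 2 = E.[x]), P = mk_ecp e.
Proof.
split=> [oP|[x [e ->]]]; last first.
  apply: has_orderP => //; first by apply/eqP; rewrite mulr2n mk_ecp_dbl0.
  by case=> [|[|i]] // _; rewrite mulr1n mk_ecp_neq0.
have : P *+ 2 == 0 by rewrite oP.
have : P *+ 1 != 0 by rewrite oP.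
rewrite mulr1n mulr2n; case: (ecp_case P) => [|x y e]; first by rewrite eqxx.
by move=> _; rewrite mk_ecp_dbl0 => /eqP y0; subst y; exists x, e.
Qed.

Lemma has_order4 x y (P : y ^+ 2 = E.[x]) : has_order (mk_ecp P) 4 <->
  y != 0 /\ exists e, E.[e] = 0 /\ E`_3 * (x - e) ^+ 2 = E^`().[e].
Proof.
split=> [oP|[y0 [e [fe h]]]].
  have y0 : y != 0 by rewrite -(mk_ecp_dbl0 P) -mulr2n oP.
  split=> //; have : has_order (mk_ecp P + mk_ecp P) 2.
    by rewrite -mulr2n; apply: has_order_mul.
  case/has_order2 => e [Q eQ]; exists e; split;
    last exact/(dbl_eq_two_torsion P Q y0).
  by rewrite -Q expr0n.
have Q : 0 ^+ 2 = E.[e] by rewrite expr0n fe.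
have eQ : mk_ecp P + mk_ecp P = mk_ecp Q by apply/(dbl_eq_two_torsion P Q y0).
have P4 : mk_ecp P *+ 4 = 0.
  rewrite (mulrnA _ 2 2) (mulr2n (mk_ecp P)) eQ mulr2n.
  by apply/eqP; rewrite mk_ecp_dbl0.
have P2 : mk_ecp P *+ 2 != 0 by rewrite mulr2n mk_ecp_dbl0.
apply: has_orderP => // i; case: i => [|[|[|[|i]]]] // _.
by apply: contraNneq P2 => P3; move: P4; rewrite mulrSr P3 add0r => ->;
  rewrite mul0rn.
Qed.
End TwoPower.

(** On a curve the generators of a cyclic subgroup of order 4 thus share their abscissa, which can
    label the subgroup. *)
Lemma cyc_order4 (G : zmodType) (P Q : G) : has_order P 4 -> has_order Q 4 ->
  cyc Q P -> P = Q \/ P = - Q.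
Proof.
move=> oP oQ [j]; rewrite -(mulrn_modn j oQ).
have Q4 : Q *+ 4 = 0 by apply/eqP; rewrite oQ.
have : (j %% 4 < 4)%N by rewrite ltn_mod.
case: (j %% 4)%N => [|[|[|[|i]]]] // _ PQ.
- by have := oP 1%N; rewrite PQ mul0rn eqxx.
- by left.
- by have := oP 2%N; rewrite PQ -mulrnA Q4 eqxx.
by right; apply/eqP; rewrite PQ -addr_eq0 -mulrSr oQ.
Qed.

(** * Stable subgroups of orders two and four, counted by real abscissas *)

Section RealStable.
Variables (R : realType) (f : {poly R}).
Hypotheses (f_cubic : size f = 4%N) (f_sep : separable_poly f).
Local Notation E := (complex_curve f_cubic f_sep).
Variable sigma : {additive ecp E -> ecp E}.
Hypothesis sigmaE : forall P, \val (sigma P) = conj_point (\val P).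

Lemma sigmaK : involutive sigma.
Proof.
move=> P; apply: val_inj; rewrite !sigmaE.
by case: (\val P) => //= x y; rewrite !conjcK.
Qed.

Lemma card_stable2 t : [set x | root f x] #= `I_t ->
  stable_cyclic sigma 2 #= `I_t.
Proof.
pose h (x : R) : set (ecp E) := [set Q : ecp E | Q = 0 \/ \val Q = Affine x%:C%C 0].
have hE x (e : 0 ^+ 2 = E.[x%:C%C]) : h x = cyc (mk_ecp e).
  have P2 : mk_ecp e *+ 2 = 0 by apply/eqP; rewrite mulr2n mk_ecp_dbl0.
  apply/seteqP; split=> [Q [->|Qe]|_ [k ->]].
  - by exists 0%N; rewrite mulr0n.
  - by exists 1%N; rewrite mulr1n; apply: val_inj.
  rewrite -(odd_double_half k) mulrnDr -mul2n mulrnA P2 mul0rn addr0.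
  by case: odd; [right | left].
have eq_root x : root f x -> 0 ^+ 2 = E.[x%:C%C].
  by move=> /rootP fx; rewrite complexify_horner fx expr0n.
have -> : stable_cyclic sigma 2 = h @` [set x | root f x].
  apply/seteqP; split=> [_ [P [oP [u su] ->]]|_ [x fx <-]]; last first.
    exists (mk_ecp (eq_root x fx)); split; [| |exact: hE].
      by apply/has_order2; exists x%:C%C, (eq_root x fx).
    exists 1%N; rewrite mulr1n; apply: val_inj; rewrite sigmaE /=.
    by congr Affine; [exact: conjc_real | exact: conjc0].
  have [x [e PE]] := (has_order2 P).1 oP; subst P.
  have sP : sigma (mk_ecp e) = mk_ecp e.
    move: su; rewrite -(mulrn_modn u oP) modn2; case: odd => // s0.
    have := sigmaK (mk_ecp e); rewrite s0 mulr0n raddf0 => /esym/eqP.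
    by rewrite (negPf (mk_ecp_neq0 _)).
  have := sigmaE (mk_ecp e); rewrite sP /= => -[/esym/conjc_fixed[v xv] _]; subst x.
  exists v; last exact: hE.
  apply/rootP; apply: complexI;
    rewrite -[LHS]/((f.[v])%:C%C) -[LHS](complexify_horner f_cubic f_sep).
  by rewrite -e expr0n.
apply: card_eq_trans; apply: inj_card_eq => x y; rewrite !inE => fx fy exy.
have : h y (mk_ecp (eq_root x fx)) by rewrite -exy (hE x (eq_root x fx));
  exact: cyc_id.
case=> [/eqP|]; first by rewrite (negPf (mk_ecp_neq0 _)).
by case.
Qed.

Lemma mk_ecp_same_x x y1 (e1 : y1 ^+ 2 = E.[x]) y2 (e2 : y2 ^+ 2 = E.[x]) :
  mk_ecp e1 = mk_ecp e2 \/ mk_ecp e1 = - mk_ecp e2.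
Proof.
have : y1 ^+ 2 == y2 ^+ 2 by rewrite e1 e2.
by rewrite eqf_sqr => /orP[] /eqP yE; [left | right]; apply: val_inj; rewrite /= yE.
Qed.

Lemma sigma_real_x (x : R) y (e : y ^+ 2 = E.[x%:C%C]) :
  sigma (mk_ecp e) = mk_ecp e \/ sigma (mk_ecp e) = - mk_ecp e.
Proof.
have e' : conjc y ^+ 2 = E.[x%:C%C].
  by rewrite -rmorphXn /= e complexify_horner; exact: conjc_real.
have -> : sigma (mk_ecp e) = mk_ecp e'; last exact: mk_ecp_same_x.
by apply: val_inj; rewrite sigmaE /=; congr Affine; exact: conjc_real.
Qed.

(** The point need not be real, but its double is: conjugation acts on the point by a sign, and that
    sign disappears on the double because it has order 2. *)
Lemma has_order4_real (x : R) y (e : y ^+ 2 = E.[x%:C%C]) :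
  has_order (mk_ecp e) 4 <->
  exists v, f.[v] = 0 /\ f`_3 * (x - v) ^+ 2 = f^`().[v].
Proof.
have c3 : E`_3 = (f`_3)%:C%C by exact: coef_map.
have cd v : E^`().[v%:C%C] = (f^`().[v])%:C%C.
  by rewrite [E^`()]deriv_map; exact: horner_map.
have relE v : (E`_3 * (x%:C%C - v%:C%C) ^+ 2 = E^`().[v%:C%C]) <->
    (f`_3 * (x - v) ^+ 2 = f^`().[v]).
  rewrite c3 cd; split=> [h1|<-]; last by rewrite [RHS]rmorphM rmorphXn rmorphB.
  by apply: complexI; rewrite -[RHS]h1 rmorphM rmorphXn rmorphB.
have rootE v : E.[v%:C%C] = 0 <-> f.[v] = 0.
  by rewrite complexify_horner; split=> [/complexI|->].
split=> [oP|[v [fv xv]]].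
  have [y0 [u [fu xu]]] := (has_order4 e).1 oP.
  have Q : 0 ^+ 2 = E.[u] by rewrite expr0n fu.
  have PQ := (dbl_eq_two_torsion e Q y0).2 xu.
  have sQ : sigma (mk_ecp Q) = mk_ecp Q.
    have QN : - mk_ecp Q = mk_ecp Q by apply: val_inj; rewrite /= oppr0.
    rewrite -PQ raddfD; case: (sigma_real_x e) => -> //.
    by rewrite -opprD PQ QN.
  have := sigmaE (mk_ecp Q); rewrite sQ /= => -[/esym/conjc_fixed[v uv] _].
  by subst u; exists v; split; [apply/rootE | apply/relE].
apply/has_order4; split; last by exists v%:C%C; split; [apply/rootE | apply/relE].
(* If [y = 0], then [x] is a root different from [v], and the relation at [v] makes it a double
   root, against separability. *)
apply/eqP => y0; move: (e); rewrite y0 expr0n /= => /esym/rootE fx.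
have /eqP := simple_root f_sep fx; apply.
have xv0 : x - v != 0.
  apply: contraTneq (simple_root f_sep fv) => h.
  by rewrite -xv h expr0n mulr0 eqxx.
have lin : 2 * f^`().[v] + (3 * f`_3 * v + f`_2) * (x - v) = 0.
  apply: (mulfI xv0); rewrite mulr0 -[RHS]fx.
  transitivity (f.[v] + (x - v) * (f`_3 * (x - v) ^+ 2
    + (3 * f`_3 * v + f`_2) * (x - v) + f^`().[v])); first by rewrite fv xv; ring.
  by rewrite !(horner_cubic f_cubic) (horner_deriv_cubic f_cubic); ring.
transitivity (f^`().[v] + 2 * (3 * f`_3 * v + f`_2) * (x - v)
    + 3 * (f`_3 * (x - v) ^+ 2)).
  by rewrite !(horner_deriv_cubic f_cubic); ring.
transitivity (2 * (2 * f^`().[v] + (3 * f`_3 * v + f`_2) * (x - v))).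
  by rewrite xv; ring.
by rewrite lin mulr0.
Qed.

Lemma card_stable4 :
  stable_cyclic sigma 4 #= `I_2 \/ stable_cyclic sigma 4 #= `I_4.
Proof.
have [s [s_uniq s_size sP]] := quarter_points f_cubic f_sep.
(* The union over both ordinates avoids choosing a square root; the two points are opposite and
   generate the same subgroup when their order is 4. *)
pose h (x : R) : set (ecp E) :=
  [set Q : ecp E | exists y (e : y ^+ 2 = E.[x%:C%C]), cyc (mk_ecp e) Q].
have cycN (P : ecp E) : has_order P 4 -> cyc P (- P).
  by move=> oP; exists 3%N; apply/eqP; rewrite eq_sym -addr_eq0 -mulrSr oP.
have ord4 x y (e : y ^+ 2 = E.[x%:C%C]) : has_order (mk_ecp e) 4 <-> x \in s.
  by rewrite has_order4_real sP.
have hE x y (e : y ^+ 2 = E.[x%:C%C]) : x \in s -> h x = cyc (mk_ecp e).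
  move=> xs; have oP := (ord4 x y e).2 xs.
  apply/seteqP; split=> [Q [z [e' QP]]|Q QP]; last by exists y, e.
  case: (mk_ecp_same_x e' e) QP => -> //; apply: cyc_sub; exact: cycN.
have lift_x x : exists y, y ^+ 2 = E.[x] by exists (sqrtc E.[x]); rewrite sqr_sqrtc.
have stableE : stable_cyclic sigma 4 = h @` [set x | x \in s].
  apply/seteqP; split=> [_ [P [oP sP' ->]]|_ [x xs <-]]; last first.
    have [y e] := lift_x x%:C%C; have oP := (ord4 x y e).2 xs.
    exists (mk_ecp e); split=> //; last exact: hE.
    by case: (sigma_real_x e) => ->; [exact: cyc_id | exact: cycN].
  have o_sP : has_order (sigma P) 4.
    by move=> j; rewrite -raddfMn raddf_eq0 ?oP //; exact: inv_inj sigmaK.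
  have := cyc_order4 o_sP oP sP'.
  case: (ecp_case P) oP {sP' o_sP} => [o0|x y e oP sPE].
    by have := o0 1%N; rewrite mul0rn eqxx.
  have cx : conjc x = x.
    have := sigmaE (mk_ecp e).
    by case: sPE => ->; rewrite /= => -[].
  have [v xv] := conjc_fixed cx; subst x.
  have vs : v \in s by apply/(ord4 v y e).
  by exists v => //; exact: hE.
have cardE : stable_cyclic sigma 4 #= `I_(size s).
  rewrite stableE; apply: card_eq_trans (card_uniq_seq s_uniq).
  apply: inj_card_eq => x z; rewrite !inE => xs zs.
  have [y e] := lift_x x%:C%C; have [t e'] := lift_x z%:C%C.
  rewrite (hE x y e) // (hE z t e') // => exz.
  have : cyc (mk_ecp e') (mk_ecp e) by rewrite -exz; exact: cyc_id.
  move/(cyc_order4 ((ord4 x y e).2 xs) ((ord4 z t e').2 zs)).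
  by case=> [/mk_ecp_inj[]|/eqP];
    [case | rewrite mk_ecp_opp => /andP[/eqP/complexI]].
by case: s_size cardE => ->; [left | right].
Qed.
End RealStable.

(** * From sets of points to cyclic subgroups of the group of points *)

Lemma cyc_opp (G : zmodType) (P Q : G) n : (0 < n)%N -> has_order P n ->
  cyc P Q -> cyc P (- Q).
Proof.
move=> n0 oP [k ->]; exists (k * n.-1)%N; apply/eqP.
rewrite eq_sym -addr_eq0 -mulrnDr -mulnSr prednK //.
by rewrite oP dvdn_mull.
Qed.

Lemma card_cyc (G : zmodType) (P : G) n : (0 < n)%N -> has_order P n ->
  cyc P #= `I_n.
Proof.
move=> n0 oP; have -> : cyc P = (fun k => P *+ k) @` `I_n.
  apply/seteqP; split=> [_ [k ->]|_ [k _ <-]]; last by exists k.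
  by exists (k %% n)%N; rewrite /= ?ltn_mod // (mulrn_modn _ oP).
apply: inj_card_eq => i j; rewrite !inE /= => li lj /eqP.
by rewrite (mulrn_eqmod _ _ oP) !modn_small // => /eqP.
Qed.

Section Translation.
Variables (R : realType) (f : {poly R}).
Hypotheses (f_cubic : size f = 4%N) (f_sep : separable_poly f).
Local Notation E := (complex_curve f_cubic f_sep).
Variable sigma : {additive ecp E -> ecp E}.
Hypothesis sigmaE : forall P, \val (sigma P) = conj_point (\val P).

Lemma ec_subgroup_mulrn (A : set (Defs.point R[i])) (P : ecp E) k :
  ec_subgroup (complexify f) A -> A (\val P) -> A (\val (P *+ k)).
Proof.
move=> [_ A0 _ AD] AP; elim: k => [|k IH] //.
by rewrite mulrS ecp_valD; exact: AD.
Qed.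

Lemma ec_subgroup_cyc (P : ecp E) n : (0 < n)%N -> has_order P n ->
  ec_subgroup (complexify f) [set \val Q | Q in cyc P].
Proof.
move=> n0 oP; split.
- by move=> _ [Q _ <-]; exact: (@ecpP _ E).
- by exists 0 => //; exists 0%N; rewrite mulr0n.
- by move=> _ [Q hQ <-]; exists (- Q) => //; exact: (cyc_opp n0).
- move=> _ _ [_ [k ->] <-] [_ [l ->] <-]; exists (P *+ (k + l)).
    by exists (k + l)%N.
  by rewrite mulrnDr ecp_valD.
Qed.

Lemma smallest_cyc (P : ecp E) n : (0 < n)%N -> has_order P n ->
  smallest (ec_subgroup (complexify f)) [set \val P] = [set \val Q | Q in cyc P].
Proof.
move=> n0 oP; apply/seteqP; split.
  apply: smallest_sub; first exact: ec_subgroup_cyc oP.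
  by move=> _ ->; exists P => //; exact: cyc_id.
move=> _ [_ [k ->] <-] A [subA PA]; apply: ec_subgroup_mulrn => //.
exact: PA.
Qed.

Lemma image_val_inj : injective (fun S : set (ecp E) => [set \val Q | Q in S]).
Proof.
suff sub (S T : set (ecp E)) : [set \val Q | Q in S] = [set \val Q | Q in T] ->
  S `<=` T.
  by move=> S T e; apply/seteqP; split; apply: sub.
move=> e Q SQ; have : [set \val Q' | Q' in T] (\val Q) by rewrite -e; exists Q.
by case=> Q' TQ' /val_inj <-.
Qed.

(** The issue is that a generator must be shown to have finite order, since [cyc] takes only natural
    multiples; its order is then [N] by counting. *)
Lemma real_cyclic_subgroupsE N : (0 < N)%N ->
  real_cyclic_subgroups f N =
  (fun S : set (ecp E) => [set \val Q | Q in S]) @` stable_cyclic sigma N.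
Proof.
move=> N0; have val_card (S : set (ecp E)) : [set \val Q | Q in S] #= S.
  by apply: inj_card_eq => P Q _ _; exact: val_inj.
apply/seteqP; split=> [S [[subS [P SE] cardS] conjS]|_ [_ [P [oP sP ->]] <-]].
  have SP : S P by rewrite SE => A [_]; exact.
  have cP : on_curve E P by apply/on_curveP; case: subS => + _ _ _; exact.
  pose Q : ecp E := ECP cP.
  have [n n0 oQ] : exists2 n, (0 < n)%N & has_order Q n.
    have [[n0 n00 Qn0]|none] := boolp.EM (exists2 n, (0 < n)%N & Q *+ n == 0).
      have ex : exists n, (0 < n)%N && (Q *+ n == 0) by exists n0; rewrite n00.
      case: (ex_minnP ex) => n /andP[n_gt0 /eqP Qn] n_min; exists n => //.
      apply: has_orderP => // i /andP[i0 lt_in].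
      by apply: contraTN lt_in => Qi; rewrite -leqNgt n_min // i0.
    (* Otherwise the multiples by [0, ..., N] would be [N + 1] distinct elements of [S]. *)
    have inj : injective (fun k => Q *+ k).
      move=> i j; wlog lt_ij : i j / (i < j)%N => [wl|] e.
        by case: (ltngtP i j) => [/wl->//|/wl h|//]; apply/esym/h.
      case: none; exists (j - i)%N; first by rewrite subn_gt0.
      by rewrite mulrnBr ?(ltnW lt_ij) // -e subrr.
    have : `I_N.+1 #<= `I_N.
      apply: (@card_le_trans _ _ _ S); last first.
        by move: cardS; rewrite card_eq_le => /andP[].
      apply: (@card_le_trans _ _ _ ((fun k => \val (Q *+ k)) @` `I_N.+1)).
        have /card_esym : (fun k => \val (Q *+ k)) @` `I_N.+1 #= `I_N.+1.
          by apply: inj_card_eq => i j _ _ /val_inj; apply: inj.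
        by rewrite card_eq_le => /andP[].
      apply: subset_card_le => _ [k _ <-]; exact: ec_subgroup_mulrn.
    by rewrite card_le_II ltnn.
  have SQ : S = [set \val T | T in cyc Q] by rewrite SE; exact: smallest_cyc oQ.
  have nN : n = N.
    apply/card_eq_II; rewrite card_eq_sym in cardS.
    rewrite card_eq_sym; apply: card_eq_trans cardS _.
    by rewrite SQ; apply: card_eq_trans (val_card _) (card_cyc n0 oQ).
  subst n; exists (cyc Q) => //; exists Q; split=> //.
  have : S (\val (sigma Q)) by rewrite sigmaE -conjS; exists P.
  by rewrite SQ => -[T QT /val_inj <-].
split; first split.
- exact: ec_subgroup_cyc oP.
- by exists (\val P); rewrite (smallest_cyc N0 oP).
- exact: card_eq_trans (val_card _) (card_cyc N0 oP).
have st Q : cyc P Q -> cyc P (sigma Q) by apply: cyc_stable.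
apply/seteqP; split=> [_ [_ [Q PQ <-] <-]|_ [Q PQ <-]].
  by exists (sigma Q); [exact: st | rewrite sigmaE].
exists (\val (sigma Q)); first by exists (sigma Q) => //; exact: st.
by rewrite -sigmaE (sigmaK sigmaE).
Qed.
End Translation.

Lemma size_odd_primes e M : (0 < e)%N -> odd M ->
  size [seq p <- primes (2 ^ e * M) | odd p] = size (primes M).
Proof.
move=> e0 M_odd; apply/perm_size/uniq_perm.
- by rewrite filter_uniq ?primes_uniq.
- exact: primes_uniq.
move=> q; rewrite mem_filter primesM ?expn_gt0 ?(odd_gt0 M_odd) // primesX //
  primes_prime // inE.
have [->|q2] := eqVneq q 2%N => /=.
  by apply/esym/negbTE; rewrite mem_primes !negb_and dvdn2 M_odd !orbT.
case qM : (q \in primes M); last by rewrite andbF.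
by move: qM; rewrite mem_primes => /and3P[_ _ /dvdn_odd -> //].
Qed.

Theorem theorem5p3 (R : realType) (f : {poly R}) (t N r : nat)
    (f_cubic : size f = 4%N) (f_sep : separable_poly f)
    (t_roots : [set x | root f x] #= `I_t)
    (N_gt0 : (0 < N)%N)
    (r_primes : size [seq p <- primes N | odd p] = r) :
  [/\ odd N ->
        real_cyclic_subgroups f N #= `I_(2 ^ r)%N,
      N = 2 %[mod 4] ->
        real_cyclic_subgroups f N #= `I_(t * 2 ^ r)%N
    & N = 4 %[mod 8] ->
        real_cyclic_subgroups f N #= `I_(2 ^ (r + 1))%N \/
        real_cyclic_subgroups f N #= `I_(2 ^ (r + 2))%N].
Proof.
have [sigma sigmaE] := conj_additive f_cubic f_sep.
have sK := sigmaK sigmaE.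
have eig n : odd n -> eigen_cyclic sigma n by exact: signed_torsion.
have card_odd M : odd M -> stable_cyclic sigma M #= `I_(2 ^ size (primes M)).
  by move=> M_odd; exact: card_stable_odd.
have cardE n : stable_cyclic sigma N #= `I_n -> real_cyclic_subgroups f N #= `I_n.
  rewrite (real_cyclic_subgroupsE sigmaE N_gt0); apply: card_eq_trans.
  by apply: inj_card_eq => S T _ _; exact: image_val_inj.
(* The congruence says that [2 ^ e] divides [N] exactly; the cofactor is [2 q + 1], where [q] is the
   quotient of [N] by [2 ^ e.+1]. *)
have split2 e : N = 2 ^ e %[mod 2 ^ e.+1] -> exists2 M, odd M & N = (2 ^ e * M)%N.
  move=> Ne; exists (N %/ 2 ^ e.+1).*2.+1; first by rewrite /= odd_double.
  rewrite {1}(divn_eq N (2 ^ e.+1)) Ne modn_small ?ltn_exp2l // expnS.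
  by move: (N %/ _)%N => q; move: (2 ^ e)%N => X; nia.
split=> [N_odd|N2|N4]; rewrite -r_primes.
- apply: cardE; have /all_filterP -> : all odd (primes N); last exact: card_odd.
  by apply/allP => p; rewrite mem_primes => /and3P[_ _ /dvdn_odd]; exact.
- have [M M_odd NE] := split2 1%N N2; apply: cardE;
    rewrite NE size_odd_primes // expn1.
  apply: card_stable_mul; rewrite ?(odd_gt0 M_odd) ?coprime2n //;
    last exact: card_odd.
  exact: (card_stable2 sigmaE).
have [M M_odd NE] := split2 2%N N4.
have mul a : stable_cyclic sigma 4 #= `I_a ->
    real_cyclic_subgroups f N #= `I_(a * 2 ^ size (primes M)).
  move=> c4; apply: cardE; rewrite NE.
  apply: card_stable_mul; rewrite ?(odd_gt0 M_odd) ?coprimeXl ?coprime2n //.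
  exact: card_odd.
rewrite [primes N](congr1 primes NE) size_odd_primes // addn1 addn2 !expnS mulnA.
by case: (card_stable4 sigmaE) => /mul h; [left | right]; exact: h.
Qed.
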